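(* For any integers $d$ and $k$, there exists a cactus $CT$ with girth at least $k$ and cycle-distance at least $d$ such that $\chi_g(CT) = 5$.
   Context: All graphs are simple, finite and undirected. The length of a path or cycle is its number of edges. The girth of a graph is the length of its shortest cycle. A cactus is a graph in which every edge belongs to at most one cycle. The cycle-distance of a cactus is the minimum length of a path between two vertices belonging to different cycles. The coloring game on a graph $G$ with a set of $k$ colors: Alice and Bob alternately color an uncolored vertex of $G$ with a color from the set so that the partial coloring remains proper (adjacent vertices get different colors); Alice wins if the whole graph gets colored, Bob wins otherwise. The game chromatic number $\chi_g(G)$ is the smallest $k$ such that Alice has a winning strategy with $k$ colors. *)

(* Defs.v *)
From mathcomp Require Import all_boot all_order all_algebra.
From mathcomp Require Import boolp.

Set Implicit Arguments.
Unset Strict Implicit.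
Unset Printing Implicit Defensive.

Record sgraph := SGraph {
  vertex :> finType;
  edge : rel vertex;
  edge_sym : symmetric edge;
  edge_irr : irreflexive edge }.

(* Minimum of a set of naturals; [None] stands for +oo, the minimum of the
   empty set. *)
Definition min_nat (P : nat -> Prop) : option nat :=
  match pselect (exists n, `[< P n >]) with
  | left exP => Some (ex_minn exP)
  | right _ => None
  end.

Definition at_least (m : option nat) (n : int) : Prop :=
  if m is Some m' then (n <= m'%:Z)%R else True.

Section Cycles.
Variable G : sgraph.

(* A cycle is a subgraph, represented by its set of edges, so that the vertex
   sequences differing by a rotation or a reversal give the same cycle. *)
Definition is_cycle (C : {set {set G}}) : Prop :=
  exists c : seq G,
    [/\ ucycle (@edge G) c, 2 < size c & C = [set [set x; next c x] | x in c]].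

Definition cactus : Prop :=
  forall (x y : G) (C1 C2 : {set {set G}}), edge x y ->
    is_cycle C1 -> is_cycle C2 ->
    [set x; y] \in C1 -> [set x; y] \in C2 -> C1 = C2.

Definition girth : option nat :=
  min_nat (fun n => exists2 C : {set {set G}}, is_cycle C & #|C| = n).

(* [cover C] is the vertex set of the cycle [C]. The path may be trivial:
   two cycles sharing a vertex are at distance 0. *)
Definition cycle_distance : option nat :=
  min_nat (fun n => exists (x : G) (p : seq G) (C1 C2 : {set {set G}}),
    [/\ path (@edge G) x p, uniq (x :: p) & size p = n] /\
    [/\ is_cycle C1, is_cycle C2, C1 <> C2,
        x \in cover C1 & last x p \in cover C2]).

End Cycles.

Section Game.
Variable G : sgraph.

Inductive player := Alice | Bob.

Section Colors.
Variable k : nat.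

Definition coloring := {ffun G -> option 'I_k}.
Definition move := (G * 'I_k)%type.

Definition blank : coloring := [ffun=> None].

Definition complete (f : coloring) : Prop := forall v, f v <> None.

Definition legal (f : coloring) (m : move) : bool :=
  (f m.1 == None) && [forall w, edge m.1 w ==> (f w != Some m.2)].

Definition play (f : coloring) (m : move) : coloring :=
  [ffun v => if v == m.1 then Some m.2 else f v].

Definition strategy := coloring -> option move.

(* [reached s t f]: a play starting with Alice on the uncolored graph, in which
   Alice follows [s] and Bob is unrestricted, may lead to [f] with [t] to
   move. *)
Inductive reached (s : strategy) : player -> coloring -> Prop :=
| ReachedBlank : reached s Alice blank
| ReachedAlice f m : reached s Alice f -> s f = Some m -> legal f m ->
    reached s Bob (play f m)
| ReachedBob f m : reached s Bob f -> legal f m -> reached s Alice (play f m).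

(* Every move colors a vertex, so plays are finite; Alice wins all the plays
   following [s] iff none of them stops before the coloring is complete. *)
Definition winning (s : strategy) : Prop :=
  forall t f, reached s t f -> ~ complete f ->
    match t with
    | Alice => exists2 m, s f = Some m & legal f m
    | Bob => exists m, legal f m
    end.

End Colors.

Definition alice_wins (k : nat) : Prop := exists s : strategy k, winning s.

Lemma alice_wins_card : exists k, `[< alice_wins k >].
Proof.
have ex_legal (f : coloring #|G|) : ~ complete f -> exists m, legal f m.
  move=> /existsNP [v /contrapT fv].
  pose used := [set c | [exists w, (w != v) && (f w == Some c)]].
  have /existsP[c cP] : [exists c, c \notin used].
    rewrite -negb_forall; apply/negP => /forallP all_used.
    pose g (w : G) := odflt (enum_rank v) (f w).
    have sub : [set: 'I_#|G|] \subset [set g w | w in [set~ v]].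
      apply/subsetP => c _; have := all_used c.
      rewrite inE => /existsP[w /andP[wv /eqP fw]].
      by apply/imsetP; exists w; rewrite ?inE // /g fw.
    have := leq_trans (subset_leq_card sub) (leq_imset_card _ _).
    rewrite cardsT card_ord cardsC1 => le.
    have G0 : 0 < #|G| by apply/card_gt0P; exists v.
    by move: le; rewrite -{1}(prednK G0) ltnn.
  exists (v, c); rewrite /legal fv eqxx /=; apply/forallP => w.
  apply/implyP => vw; apply: contra cP => fw; rewrite inE.
  apply/existsP; exists w; rewrite fw andbT.
  by apply: contraTneq vw => ->; rewrite edge_irr.
exists #|G|; apply/asboolP; exists (fun f => [pick m | legal f m]).
move=> t f _ /ex_legal [m fm]; case: t; last by exists m.
by case: pickP => [m' fm'|/(_ m)]; [exists m' | rewrite fm].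
Qed.

Definition game_chromatic_number : nat := ex_minn alice_wins_card.

End Game.

(* Main.v *)
(** Alice always wins with five colors, since the graph below is a forest plus
    a matching: she answers in the rooted forest so that an uncolored vertex
    has at most two children with colored descendants, hence at most
    2 + 1 + 1 colored neighbors.

    With at most four colors, Bob works on a skeleton whose vertices carry many
    pendant leaves, so that he can forbid any color at any skeleton vertex.
    A vertex with three forbidden colors on his turn is won.  A path of
    uncolored vertices joining a vertex with two forbidden colors [a], [b] to
    one with a forbidden color [z] is won as soon as [z \in {a, b}] exactly
    when the length is odd ([bob_wins_path]).  Running around an odd cycle,
    or through one, provides the missing parity: forbidding a color at
    one vertex of a fresh odd cycle is a threat that Alice can only meet on
    that cycle ([bob_attacks_cycle]).  So Bob keeps the move while forcing
    colored vertices at the far ends of many long arms, each crossing another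
    odd cycle.  Four consecutive vertices carrying such arms, on which any two
    forbidden colors are now fatal, are then lost for Alice.

    No cycle length or distance enters these arguments except by parity, so
    both can be taken arbitrarily large. *)
Require Import Defs.
From mathcomp Require Import all_boot all_order all_algebra.
From mathcomp Require Import boolp zify.

Set Implicit Arguments.
Unset Strict Implicit.
Unset Printing Implicit Defensive.

(** * Bob's strategy *)

Lemma head_rev (T : Type) (x : T) s : head x (rev s) = last x s.
Proof. by case/lastP: s => // s y; rewrite rev_rcons last_rcons. Qed.

Lemma last_rev (T : Type) (x : T) s : last x (rev s) = head x s.
Proof. by rewrite -head_rev revK. Qed.

(** * Moves, colored vertices and winning for Bob *)

Section Play.
Variables (G : sgraph) (k : nat).
Implicit Types (f : coloring G k) (v w x : G) (m : move G k).

Definition colored f : {set G} := [set v | f v != None].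

Lemma play_at f m : play f m m.1 = Some m.2.
Proof. by rewrite /play ffunE eqxx. Qed.

Lemma play_other f m w : w != m.1 -> play f m w = f w.
Proof. by rewrite /play ffunE => /negPf ->. Qed.

Lemma play_mono f m w c : legal f m -> f w = Some c -> play f m w = Some c.
Proof.
case/andP => /eqP fm _ fw; rewrite play_other //.
by apply/eqP => E; rewrite -E fw in fm.
Qed.

Lemma colored_play f m : colored (play f m) = m.1 |: colored f.
Proof.
apply/setP => w; rewrite !inE; have [->|ne] := eqVneq w m.1.
  by rewrite play_at.
by rewrite play_other.
Qed.

Lemma card_colored_play f m : legal f m ->
  #|colored (play f m)| = #|colored f|.+1.
Proof. by case/andP => fm _; rewrite colored_play cardsU1 inE fm. Qed.

(** Winning for Bob is phrased as unreachability under every winning strategy of Alice, so that no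
    strategy of Bob has to be built as an object. *)
Definition bob_wins t f := forall s, winning s -> reached s t f -> False.

Lemma not_complete f v : f v = None -> ~ complete f.
Proof. by move=> fv /(_ v). Qed.

Lemma bob_wins_move f m : legal f m ->
  bob_wins Alice (play f m) -> bob_wins Bob f.
Proof. by move=> fm bw s win r; exact: (bw s win (ReachedBob r fm)). Qed.

Lemma bob_wins_reply f v : f v = None ->
  (forall m, legal f m -> bob_wins Bob (play f m)) -> bob_wins Alice f.
Proof.
move=> fv bw s win r.
have [m sm lm] := win _ _ r (not_complete fv).
exact: (bw m lm s win (ReachedAlice r sm lm)).
Qed.

End Play.

(** * Forbidden colors and Bob's rounds with at most four colors *)

Section FewColors.
Variables (G : sgraph) (k : nat).
Hypothesis k_le4 : k <= 4.
Implicit Types (f : coloring G k) (v w x : G) (m : move G k) (c : 'I_4).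

(* Colors that do not exist count as forbidden, so that one argument with
   four colors covers every [k <= 4]. *)
Definition forb f v c : bool :=
  (k <= c) || [exists w, edge v w && (omap val (f w) == Some (val c))].

Definition col4 (c : 'I_k) : 'I_4 := widen_ord k_le4 c.

Lemma forb_play f m v c : legal f m -> forb f v c -> forb (play f m) v c.
Proof.
move=> lm /orP[kc|/existsP[w /andP[vw /eqP fw]]]; apply/orP; [by left|right].
apply/existsP; exists w; rewrite vw /=; case E: (f w) fw => [d|] //= fw.
by rewrite (play_mono lm E) /= fw.
Qed.

Lemma forb_play_at f m v : edge m.1 v -> forb (play f m) v (col4 m.2).
Proof.
move=> mv; apply/orP; right; apply/existsP; exists m.1.
by rewrite edge_sym mv play_at /=.
Qed.

Lemma legal_forb f m : legal f m -> ~~ forb f m.1 (col4 m.2).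
Proof.
case/andP => _ /forallP lm; rewrite /forb /= leqNgt ltn_ord /=.
apply/existsPn => w; rewrite negb_and orbC -implybE.
apply/implyP => /eqP fw; apply/negP => mw.
have := lm w; rewrite mw /=; case E: (f w) fw => [d|] //= [] /val_inj ->.
by rewrite eqxx.
Qed.

Lemma forb_legal f v c : f v = None -> ~~ forb f v c ->
  exists2 d : 'I_k, legal f (v, d) & col4 d = c.
Proof.
move=> fv; rewrite /forb negb_or -ltnNge => /andP[ck /existsPn nf].
exists (Ordinal ck); last exact: val_inj.
rewrite /legal /= fv eqxx /=; apply/forallP => w; apply/implyP => vw.
by have := nf w; rewrite vw /=; apply: contra => /eqP ->.
Qed.

(** A vertex without an available color stays so, since [forb] persists and a legal move never uses
    a forbidden color. A winning strategy keeps the play going as long as [v] is uncolored, but each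
    move uses up an uncolored vertex; hence the induction on their number. *)
Lemma dead_bob_wins t f v : f v = None -> (forall c, forb f v c) ->
  bob_wins t f.
Proof.
have [n] := ubnP #|~: colored f|; elim: n => // n IH in t f *.
move=> lt_n fv dead s win r.
have step m : legal f m -> forall t', reached s t' (play f m) -> False.
  move=> lm t' r'; have mv : v != m.1.
    by apply: contraL (legal_forb lm) => /eqP <-; rewrite negbK.
  apply: (IH t' (play f m) _ _ _ s win r').
  - apply: leq_trans (ltnSE lt_n); apply: proper_card.
    rewrite colored_play; apply/properP; split.
      by apply/subsetP => w; rewrite !inE negb_or => /andP[].
    by exists m.1; rewrite !inE ?eqxx //; case/andP: lm => /eqP ->.
  - by rewrite play_other.
  - by move=> c; exact: forb_play.
have := win _ _ r (not_complete fv); case: t r => r.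
  by case=> m sm lm; exact: (step m lm _ (ReachedAlice r sm lm)).
by case=> m lm; exact: (step m lm _ (ReachedBob r lm)).
Qed.

Lemma compl_colors (a b : 'I_4) : a != b ->
  exists c d, [/\ c != d, a != c, a != d, b != c & b != d]
    /\ forall x : 'I_4, [|| x == a, x == b, x == c | x == d].
Proof.
move=> ab; have : #|[set~ a] :\ b| = 2.
  have := cardsD1 b [set~ a]; rewrite cardsC1 card_ord !inE eq_sym ab /=.
  by case.
move/eqP/cards2P => [c [d [cd E]]].
have inE' (x : 'I_4) : (x != b) && (x != a) = (x == c) || (x == d).
  by have := congr1 (fun A : {set _} => x \in A) E; rewrite !inE.
exists c, d; split.
  have := inE' c; have := inE' d; rewrite !eqxx orbT /=.
  by move=> /andP[? ?] /andP[? ?]; split; rewrite // eq_sym.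
by move=> x; have := inE' x; case: (x == a); case: (x == b).
Qed.

Variables (M : nat) (inner : pred G) (leaf : G -> 'I_M -> G).
Hypothesis leaf_inj : forall v, injective (leaf v).
Hypothesis edge_leaf : forall v j w, inner v -> edge (leaf v j) w = (w == v).
Hypothesis leaf_inner : forall v j, inner v -> ~~ inner (leaf v j).

(** Comparing all colored vertices with [M] is crude but provides a fresh leaf or kid in every
    round. The later bounds of the form [#|colored f| + _ <= M] reserve two colored vertices per
    round. *)
Lemma free_vertex f (h : 'I_M -> G) : injective h -> #|colored f| < M ->
  exists j, f (h j) = None.
Proof.
move=> h_inj lt_M.
have: ~~ ([set h j | j : 'I_M] \subset colored f).
  apply: contraL lt_M => /subset_leq_card.
  by rewrite card_imset // card_ord -leqNgt.
case/subsetPn => _ /imsetP[j _ ->]; rewrite inE negbK => /eqP fj; by exists j.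
Qed.

(* [after f v a x g f']: from [f], Bob made [a] forbidden at [v] by coloring a
   leaf and Alice answered by coloring [x] with [g]. *)
Record after f v (a : 'I_4) x (g : 'I_4) f' : Prop := After {
  after_inner : forall w, inner w -> w != x -> f' w = f w;
  after_forb : forall w c, forb f w c -> forb f' w c;
  after_add : forb f' v a;
  after_nbr : forall w, edge x w -> forb f' w g;
  after_new : forall c, forb f x c -> g != c;
  after_newv : x = v -> g != a;
  after_card : #|colored f'| <= #|colored f| + 2 }.

(** If [a] is available at [v], Bob gives it to a free leaf, which is legal because [v], the only
    neighbor of the leaf, is uncolored. If [a] is forbidden already, Bob must still move: he uses
    any available color [d] instead, and if there is none then [v] is dead. *)
Lemma bob_round f v a : inner v -> f v = None -> #|colored f| < M ->
  (forall x g f', after f v a x g f' -> bob_wins Bob f') -> bob_wins Bob f.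
Proof.
move=> iv fv ltM next.
have [j fj] := free_vertex (@leaf_inj v) ltM.
have add d : ~~ forb f v d -> (forb f v a \/ a = d) -> bob_wins Bob f.
  move=> nd ad.
  have nl : ~~ forb f (leaf v j) d.
    rewrite /forb negb_or; have /norP[-> _] := nd; apply/existsPn => w.
    by rewrite edge_leaf //; apply/negP => /andP[/eqP ->]; rewrite fv.
  have [e le ed] := forb_legal fj nl.
  have vl : edge (leaf v j) v by rewrite edge_leaf.
  have neq w : inner w -> w != leaf v j.
    by move=> iw; apply: contraNneq (leaf_inner j iv) => <-.
  apply: (bob_wins_move le); apply: (@bob_wins_reply _ _ _ v).
    by rewrite play_other //; exact: neq.
  move=> m lm; have fva : forb (play f (leaf v j, e)) v a.
    case: ad => [fa|->]; first exact: forb_play.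
    by rewrite -ed; exact: (@forb_play_at f (leaf v j, e)).
  apply: (next m.1 (col4 m.2)); split.
  - by move=> w iw wm; rewrite !play_other //; exact: neq.
  - by move=> w c /(forb_play le); exact: forb_play.
  - exact: forb_play.
  - by move=> w; exact: forb_play_at.
  - by move=> c /(forb_play le); apply: contraTneq => <-; exact: legal_forb.
  - move=> E; apply: contraTneq fva => <-.
    by rewrite -[X in forb _ X]E; exact: legal_forb.
  - by rewrite !card_colored_play // addn2.
have [fa|na] := boolP (forb f v a); last by apply: (add a) => //; right.
case: (pickP (fun d => ~~ forb f v d)) => [d nd|all].
  by apply: (add d) => //; left.
by apply: (dead_bob_wins fv) => c; have /negbFE := all c.
Qed.

(** Bob forbids the fourth color. Alice cannot rescue [v] by coloring it in reply, since all four
    colors are forbidden there by then. *)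
Lemma bob_wins3 f v a b c : inner v -> f v = None -> #|colored f| < M ->
  a != b -> a != c -> b != c -> forb f v a -> forb f v b -> forb f v c ->
  bob_wins Bob f.
Proof.
move=> iv fv ltM ab ac bc fa fb fc.
have [d [e [[de ad ae bd be] all]]] := compl_colors ab.
(* Of the two colors outside [a], [b], the one named [d] may be taken to be [c]; then [e] is the
   fourth color. *)
wlog cd : d e de ad ae bd be all / c = d => [H|].
  have := all c; rewrite eq_sym (negPf ac) eq_sym (negPf bc) /=.
  case/orP => /eqP E; first exact: (H d e).
  apply: (H e d) => //; first by rewrite eq_sym.
  by move=> x; rewrite [(x == e) || _]orbC.
subst d; apply: (@bob_round f v e) => // x g f' A.
apply: (@dead_bob_wins _ _ v).
  rewrite (after_inner A) //; apply/eqP => E; subst x.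
  have := all g; rewrite (negPf (after_new A fa)) (negPf (after_new A fb)).
  by rewrite (negPf (after_new A fc)) (negPf (after_newv A erefl)).
move=> h; case/or4P: (all h) => /eqP ->.
- exact: after_forb A _ _ fa.
- exact: after_forb A _ _ fb.
- exact: after_forb A _ _ fc.
- exact: after_add A.
Qed.

Lemma sorted_rev_edge (s : seq G) : sorted (@edge G) s ->
  sorted (@edge G) (rev s).
Proof.
case: s => // u s e_s; rewrite rev_sorted /= (eq_path (e' := @edge G)) //.
by move=> x y; rewrite edge_sym.
Qed.


Definition blank_on f := all (fun w => inner w && (f w == None)).

Lemma blank_onP f s w : blank_on f s -> w \in s -> inner w /\ f w = None.
Proof. by move=> /allP /[apply] /andP[-> /eqP]. Qed.

Lemma after_blank_on f v a x g f' s : after f v a x g f' -> x \notin s ->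
  blank_on f s -> blank_on f' s.
Proof.
move=> A xs /allP fs; apply/allP => w ws; have /andP[iw fw] := fs w ws.
by rewrite iw (after_inner A) //; apply: contraNneq xs => <-.
Qed.

(** Bob forbids a second color [y] at the far end, chosen so that wherever Alice cuts the path, one
    of the pieces meets the parity condition again. If she plays off the path, Bob forces her to
    color the head, and the rest of the path, reversed, meets the condition. Each path vertex pays
    for two rounds, that is, for four colored vertices. *)
Lemma bob_wins_path n (s : seq G) d f a b z : size s <= n ->
  s != [::] -> sorted (@edge G) s -> uniq s -> blank_on f s ->
  a != b -> forb f (head d s) a -> forb f (head d s) b ->
  forb f (last d s) z -> (z == a) || (z == b) = ~~ odd (size s) ->
  #|colored f| + 4 * size s <= M -> bob_wins Bob f.
Proof.
elim: n => [|n IH] in s f a b z *; first by case: s.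
move=> le_n s0 e_s u_s b_s ab fa fb fz par le_M.
have [c [e [[ce ac ae bc be] all4]]] := compl_colors ab.
have hd_s : head d s \in s by case: (s) s0 => //= *; rewrite inE eqxx.
have tl_s : last d s \in s by case: (s) s0 => //= *; rewrite mem_last.
have [iv0 fv0] := blank_onP b_s hd_s.
have [ivl fvl] := blank_onP b_s tl_s.
have ltM : #|colored f| < M.
  apply: leq_trans le_M; rewrite -[X in X < _]addn0 ltn_add2l muln_gt0 /=.
  by rewrite lt0n size_eq0.
have [s1|s_gt1] := leqP (size s) 1.
  have [v E] : exists v, s = [:: v].
    by case: (s) s0 s1 => [|v []] // _ _; exists v.
  move: par; rewrite E /= => /norP[za zb].
  move: fz fa fb fv0 iv0; rewrite E /= => fz fa fb fv0 iv0.
  by apply: (bob_wins3 iv0 fv0 ltM ab _ _ fa fb fz); rewrite eq_sym.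
have forced f' y : blank_on f' s -> forb f' (head d s) a ->
    forb f' (head d s) b -> forb f' (last d s) z -> forb f' (last d s) y ->
    z != y -> #|colored f'| + 4 * size s <= M + 2 -> bob_wins Bob f'.
  clear f b_s fa fb fz le_M fv0 fvl ltM => b_s fa fb fz fy zy le_M.
  have ltM : #|colored f'| < M by clear -le_M s_gt1; lia.
  have [_ fv0] := blank_onP b_s hd_s.
  (* Bob will forbid [r'] at the head, which leaves Alice only [r] there. The path then loses one
     vertex, so [r] has to be in [{z, y}] exactly when the present number of vertices is odd. *)
  have [r [r' [[rr ar ar' br br'] allr parr]]] : exists r r' : 'I_4,
      [/\ [/\ r != r', a != r, a != r', b != r & b != r'],
      forall x : 'I_4, [|| x == a, x == b, x == r | x == r']
      & (r == z) || (r == y) = odd (size s)].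
    have all4' (x : 'I_4) : [|| x == a, x == b, x == e | x == c].
      by rewrite [(x == e) || _]orbC.
    have ec : e != c by rewrite eq_sym.
    case: (boolP (odd (size s))) par => _ /=.
      move=> /norP[za zb]; have := all4 z; rewrite (negPf za) (negPf zb) /=.
      by case/orP => /eqP E; [exists c, e | exists e, c]; rewrite E eqxx.
    move=> zab; have [E|cy] := eqVneq c y;
      [exists e, c|exists c, e]; split=> //.
      rewrite -E (negPf ec) orbF; case/orP: zab => /eqP ->.
        by rewrite eq_sym (negPf ae).
      by rewrite eq_sym (negPf be).
    rewrite (negPf cy) orbF; case/orP: zab => /eqP ->.
      by rewrite eq_sym (negPf ac).
    by rewrite eq_sym (negPf bc).
  apply: (bob_round (a := r') iv0 fv0 ltM) => x g f A.
  have [xE|xv] := eqVneq x (head d s); last first.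
    apply: (bob_wins3 iv0 _ _ ab ar' br' _ _ (after_add A)).
    - by rewrite (after_inner A) // eq_sym.
    - by have := after_card A; clear -le_M s_gt1; lia.
    - exact: after_forb A _ _ fa.
    - exact: after_forb A _ _ fb.
  have gr : g = r.
    have := allr g; move: (after_new A); rewrite xE => new.
    rewrite (negPf (new _ fa)) (negPf (new _ fb)).
    by rewrite (negPf (after_newv A xE)) orbF /= => /eqP.
  have [v0 [v1 [p E]]] : exists v0 v1 p, s = [:: v0, v1 & p].
    by case: (s) s_gt1 => [|v0 [|v1 p]] // _; exists v0, v1, p.
  subst s; rewrite /= in le_n e_s u_s xE; subst x.
  case/and3P: u_s => v0p v1p u_p; case/andP: e_s => e01 e_p.
  apply: (IH (rev (v1 :: p)) f z y r) => //.
  - by rewrite size_rev.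
  - by rewrite -size_eq0 size_rev.
  - exact: (@sorted_rev_edge (v1 :: p)).
  - by rewrite rev_uniq /= v1p.
  - apply: (after_blank_on A); rewrite ?mem_rev //.
    by rewrite /blank_on all_rev; case/andP: b_s.
  - by rewrite head_rev; exact: after_forb A _ _ fz.
  - by rewrite head_rev; exact: after_forb A _ _ fy.
  - by rewrite last_rev /= -gr; exact: after_nbr A _ e01.
  - by rewrite size_rev /= parr /= negbK.
  - by rewrite size_rev /=; move: (after_card A) le_M => /=; clear; lia.
(* The pair [{z, y}] is [{a, b}] when the number of vertices is even, and the complementary pair
   when it is odd. *)
have [y [zy parg]] : exists y, z != y /\ forall g : 'I_4,
    (g == z) || (g == y) = ((g == a) || (g == b)) (+) odd (size s).
  have all4' (g : 'I_4) : (g == c) || (g == e) = ~~ ((g == a) || (g == b)).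
    have := all4 g; have [->|_] := eqVneq g a.
      by rewrite (negPf ac) (negPf ae).
    have [->|_] := eqVneq g b; first by rewrite (negPf bc) (negPf be).
    by move=> /= ->.
  case: (odd (size s)) par => /=.
    move=> /norP[za zb]; have := all4 z; rewrite (negPf za) (negPf zb) /=.
    case/orP => /eqP ->; [exists e | exists c]; split; try by rewrite // eq_sym.
      by move=> g; rewrite all4' addbT.
    by move=> g; rewrite orbC all4' addbT.
  case/orP => /eqP ->; [exists b | exists a]; split; try by rewrite // eq_sym.
    by move=> g; rewrite addbF.
  by move=> g; rewrite addbF orbC.
apply: (bob_round (a := y) ivl fvl ltM) => x g f' A.
have [xs|xs] := boolP (x \in s); last first.
  apply: (forced f' y) => //.
  - exact: after_blank_on A xs b_s.
  - exact: after_forb A _ _ fa.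
  - exact: after_forb A _ _ fb.
  - exact: after_forb A _ _ fz.
  - exact: after_add A.
  - by have := after_card A; clear -le_M; lia.
move: (after_card A) (parg g) => leA {forced} pg.
have [s1 [s2 E]] : exists s1 s2, s = s1 ++ x :: s2.
  by case/splitPr: xs => s1 s2; exists s1, s2.
subst s; rewrite size_cat /= in le_n le_M pg.
have [us1 /= /andP[xs2 us2] xs1] : [/\ uniq s1, uniq (x :: s2) & x \notin s1].
  move: u_s; rewrite cat_uniq => /and3P[-> H ->]; split=> //.
  by apply: contra H => xs1; apply/hasP; exists x; rewrite ?mem_head.
have [bs1 bs2] : blank_on f s1 /\ blank_on f s2.
  by move: b_s; rewrite /blank_on all_cat /= => /and3P[].
have left : s1 != [::] -> (g == a) || (g == b) = ~~ odd (size s1) ->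
    bob_wins Bob f'.
  case E1: s1 => [|v s1'] // _ pl; subst s1; rename s1' into s1.
  move: e_s; rewrite /= cat_path /= => /and3P[e1 e2 e3].
  apply: (IH (v :: s1) f' a b g) => //.
  - by move: le_n => /=; clear; lia.
  - exact: after_blank_on A xs1 bs1.
  - exact: after_forb A _ _ fa.
  - exact: after_forb A _ _ fb.
  - by apply: (after_nbr A); rewrite edge_sym.
  - by move: leA le_M => /=; clear; lia.
have right : s2 != [::] -> (g == z) || (g == y) = ~~ odd (size s2) ->
    bob_wins Bob f'.
  case E2: s2 => [|v s2'] // _ pl; subst s2; rename s2' into s2.
  have [exv e3] : edge x v /\ path (@edge G) v s2.
    move: e_s; case: (s1) => [|w s1'] /=; first by case/andP.
    by rewrite cat_path /= => /and4P[].
  apply: (IH (rev (v :: s2)) f' z y g) => //.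
  - by rewrite size_rev; move: le_n => /=; clear; lia.
  - by rewrite -size_eq0 size_rev.
  - exact: (@sorted_rev_edge (v :: s2)).
  - by rewrite rev_uniq.
  - apply: (after_blank_on A); rewrite ?mem_rev //.
    by rewrite /blank_on all_rev.
  - rewrite head_rev; apply: after_forb A _ _ _.
    by move: fz; rewrite last_cat.
  - by rewrite head_rev; move: (after_add A); rewrite last_cat.
  - by rewrite last_rev /=; exact: after_nbr A _ exv.
  - by rewrite size_rev.
  - by rewrite size_rev; move: leA le_M => /=; clear; lia.
(* An empty piece is never the one required: when Alice colors an end of the path, [g] differs from
   the two colors forbidden there, and parity then favors the other piece. *)
case: (eqVneq s1 [::]) => [E1|n1].
  apply: right; first by move: s_gt1; rewrite E1; case: (s2).
  rewrite pg E1 /=; move: fa fb; rewrite E1 /= => fa fb.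
  rewrite (negPf (after_new A fa)) (negPf (after_new A fb)) /=.
  by rewrite ?add0n.
case: (eqVneq s2 [::]) => [E2|n2].
  apply: left => //; move: pg fz (after_newv A).
  rewrite E2 last_cat /= => pg fz /(_ erefl) gy.
  move: pg; rewrite (negPf (after_new A fz)) (negPf gy) /= addn1 /=.
  by case: (_ || _); case: odd.
have [pl|npl] := eqVneq ((g == a) || (g == b)) (~~ odd (size s1)).
  exact: left.
apply: right => //; rewrite pg addnS /= oddD.
by move: npl; case: (_ || _); case: (odd (size s1)); case: odd.
Qed.

(** * Runs of vertices sharing a forbidden color, and odd cycles *)

Lemma blank_on_sub f (s1 s2 : seq G) : {subset s1 <= s2} ->
  blank_on f s2 -> blank_on f s1.
Proof. by move=> sub /allP b2; apply/allP => w /sub /b2. Qed.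

Lemma bob_wins_edge f u v a b : edge u v -> blank_on f [:: u; v] ->
  a != b -> forb f u a -> forb f u b -> forb f v a ->
  #|colored f| + 8 <= M -> bob_wins Bob f.
Proof.
move=> uv b_uv ab fua fub fva le_M.
apply: (@bob_wins_path 2 [:: u; v] u f a b a) => //=; rewrite ?uv ?eqxx //.
by rewrite inE andbT; apply: contraTneq uv => ->; rewrite edge_irr.
Qed.

Lemma other_color (a : 'I_4) : exists b, a != b.
Proof.
have [E|ne] := eqVneq a ord0; last by exists ord0.
by exists ord_max; rewrite E.
Qed.

Ltac sub_in :=
  by rewrite !inE; repeat (case/orP); move=> ->; rewrite ?orbT.
Ltac sub_seq := by move=> ?; sub_in.

(** Bob forbids a second color at [v]. Every reply leaves an edge for [bob_wins_edge]: [t s] if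
    Alice colors [v], [v t] if she colors [u], and [v u] otherwise. *)
Lemma bob_wins_run4 f u v t s a :
  edge u v -> edge v t -> edge t s -> uniq [:: u; v; t; s] ->
  blank_on f [:: u; v; t; s] ->
  forb f u a -> forb f v a -> forb f t a -> forb f s a ->
  #|colored f| + 10 <= M -> bob_wins Bob f.
Proof.
move=> uv vt ts uq bl fu fv ft fs le_M.
have [b ab] := other_color a.
have [iv fv0] : inner v /\ f v = None.
  by apply: (blank_onP bl); rewrite !inE eqxx orbT.
apply: (bob_round (a := b) iv fv0); first by clear -le_M; lia.
move=> x g f' A; have leA := after_card A.
have [xv|xv] := eqVneq x v.
  subst x; have ag : a != g by rewrite eq_sym; exact: (after_new A).
  apply: (@bob_wins_edge f' t s a g ts) => //.
  - apply: (after_blank_on A).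
      move: uq => /= /and4P[_]; rewrite !inE !negb_or => /andP[-> ->] //.
    by apply: blank_on_sub bl; sub_seq.
  - exact: after_forb A _ _ ft.
  - exact: after_nbr A _ vt.
  - exact: after_forb A _ _ fs.
  - by clear -leA le_M; lia.
have [xu|xu] := eqVneq x u.
  subst x; apply: (@bob_wins_edge f' v t a b vt) => //.
  - apply: (after_blank_on A).
      by move: uq => /= /andP[]; rewrite !inE !negb_or => /and3P[-> -> _].
    by apply: blank_on_sub bl; sub_seq.
  - exact: after_forb A _ _ fv.
  - exact: after_add A.
  - exact: after_forb A _ _ ft.
  - by clear -leA le_M; lia.
apply: (@bob_wins_edge f' v u a b) => //.
- by rewrite edge_sym.
- apply: (after_blank_on A); first by rewrite !inE negb_or xv.
  by apply: blank_on_sub bl; sub_seq.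
- exact: after_forb A _ _ fv.
- exact: after_add A.
- exact: after_forb A _ _ fu.
- by clear -leA le_M; lia.
Qed.

Variables (spine : pred G) (kid : G -> 'I_M -> G).
Hypothesis spine_inner : forall v, spine v -> inner v.
Hypothesis kid_inj : forall v, injective (kid v).
Hypothesis edge_kid : forall v j, spine v -> edge v (kid v j).
Hypothesis kid_inner : forall v j, spine v -> inner (kid v j).
Hypothesis kid_spine : forall v j, spine v -> ~~ spine (kid v j).

(** Bob prolongs the run by a kid of [t]. A reply off the four vertices leads to [bob_wins_run4]. A
    reply on them uses a color other than [a], which becomes a second forbidden color at a neighbor,
    next to an uncolored vertex where [a] is forbidden. *)
Lemma bob_wins_run3 f u v t a : edge u v -> edge v t ->
  uniq [:: u; v; t] -> all spine [:: u; v; t] -> blank_on f [:: u; v; t] ->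
  forb f u a -> forb f v a -> forb f t a ->
  #|colored f| + 12 <= M -> bob_wins Bob f.
Proof.
move=> uv vt uq /and4P[su sv st _] bl fu fv ft le_M.
have ltM : #|colored f| < M by clear -le_M; lia.
have [j fs] := free_vertex (@kid_inj t) ltM.
set s := kid t j in fs.
have is' : inner s by exact: kid_inner.
have ts : edge t s by exact: edge_kid.
have ns w : spine w -> w != s.
  by move=> sw; apply: contraTneq sw => ->; exact: kid_spine.
have bl4 : blank_on f [:: u; v; t; s].
  by move: bl; rewrite /blank_on /= is' fs eqxx => /and4P[-> -> -> _].
have uq4 : uniq [:: u; v; t; s].
  move: uq; rewrite /= !inE !negb_or (ns u) // (ns v) // (ns t) // !andbT.
  by [].
apply: (bob_round (a := a) is' fs ltM) => x g f' A.
have leA := after_card A.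
have sub4 (s' : seq G) : {subset s' <= [:: u; v; t; s]} -> x \notin s' ->
    blank_on f' s'.
  by move=> sub xs; apply: (after_blank_on A) => //; exact: blank_on_sub bl4.
have [fu' fv'] := (after_forb A fu, after_forb A fv).
have ft' := after_forb A ft.
have [x4|x4] := boolP (x \in [:: u; v; t; s]); last first.
  apply: (@bob_wins_run4 f' u v t s a) => //.
  - exact: sub4.
  - exact: after_add A.
  - by clear -leA le_M; lia.
have le8 : #|colored f'| + 8 <= M by clear -leA le_M; lia.
move: x4; rewrite !inE => x4.
have ag : forb f x a || (x == s) -> a != g.
  rewrite [a == g]eq_sym; case/orP; first exact: (after_new A).
  by move/eqP; exact: (after_newv A).
move: uq4; rewrite /= !inE !negb_or !andbT.
case/and3P=> /and3P[nuv nut nus] /andP[nvt nvs] nts.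
case/or4P: x4 => /eqP xE; rewrite xE in A sub4 ag.
- apply: (@bob_wins_edge f' v t a g) => //; rewrite ?ag ?fu //.
  + by apply: sub4; [sub_seq | rewrite !inE negb_or nuv nut].
  + exact: after_nbr A _ uv.
- apply: (@bob_wins_edge f' t s a g) => //; rewrite ?ag ?fv //.
  + by apply: sub4; [sub_seq | rewrite !inE negb_or nvt nvs].
  + exact: after_nbr A _ vt.
  + exact: after_add A.
- apply: (@bob_wins_edge f' v u a g) => //; rewrite ?ag ?ft //.
  + by rewrite edge_sym.
  + apply: sub4; first sub_seq.
    by rewrite !inE negb_or eq_sym nvt eq_sym nut.
  + by apply: (after_nbr A); rewrite edge_sym.
- apply: (@bob_wins_edge f' t v a g) => //; rewrite ?ag ?eqxx ?orbT //.
  + by rewrite edge_sym.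
  + apply: sub4; first sub_seq.
    by rewrite !inE negb_or eq_sym nts eq_sym nvs.
  + by apply: (after_nbr A); rewrite edge_sym.
Qed.

(** This lets Bob dictate a move: once [a] is forbidden at [t] too, every reply other than coloring
    the middle vertex [v] loses by [bob_wins_edge] or [bob_wins_run3]. *)
Lemma bob_extends_run f u v t a : edge u v -> edge v t ->
  uniq [:: u; v; t] -> all spine [:: u; v; t] -> blank_on f [:: u; v; t] ->
  forb f u a -> forb f v a -> #|colored f| + 14 <= M ->
  (forall g f', after f t a v g f' -> bob_wins Bob f') -> bob_wins Bob f.
Proof.
move=> uv vt uq sp bl fu fv le_M mid.
have [it ft] : inner t /\ f t = None.
  by apply: (blank_onP bl); rewrite !inE eqxx !orbT.
apply: (bob_round (a := a) it ft); first by clear -le_M; lia.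
move=> x g f' A; have leA := after_card A.
have sub (s' : seq G) : {subset s' <= [:: u; v; t]} -> x \notin s' ->
    blank_on f' s'.
  by move=> sub xs; apply: (after_blank_on A) => //; exact: blank_on_sub bl.
have [fu' fv'] := (after_forb A fu, after_forb A fv).
have le8 : #|colored f'| + 8 <= M by clear -leA le_M; lia.
move: (uq); rewrite /= !inE !negb_or !andbT => /andP[/andP[nuv nut] nvt].
have [xv|xv] := eqVneq x v; first by subst x; exact: (mid g f').
have [xu|xu] := eqVneq x u.
  subst x; apply: (@bob_wins_edge f' v t a g) => //.
  + by apply: sub; [sub_seq | rewrite !inE negb_or nuv nut].
  + by rewrite eq_sym; exact: (after_new A).
  + exact: after_nbr A _ uv.
  + exact: after_add A.
have [xt|xt] := eqVneq x t.
  subst x; apply: (@bob_wins_edge f' v u a g) => //.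
  + by rewrite edge_sym.
  + by apply: sub; [sub_seq | rewrite !inE negb_or xv xu].
  + by rewrite eq_sym; exact: (after_newv A).
  + by apply: (after_nbr A); rewrite edge_sym.
apply: (@bob_wins_run3 f' u v t a) => //.
- by apply: sub => //; rewrite !inE !negb_or xu xv xt.
- exact: after_add A.
- by clear -leA le_M; lia.
Qed.

(** The cycle is odd, as [c] has even size. Bob forbids [a] at the neighbor [y1] of [y] as well. If
    Alice colors [y] or [y1], the rest of the cycle is a path with an even number of vertices and
    her color forbidden at both ends. Otherwise [bob_extends_run] makes her color the middle of a
    run of three, which opens the cycle into one suitable path, or into two paths of different
    parities. *)
Lemma bob_wins_cycle f (c : seq G) y a : cycle (@edge G) (y :: c) ->
  uniq (y :: c) -> all spine (y :: c) -> blank_on f (y :: c) ->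
  ~~ odd (size c) -> 3 < size c -> forb f y a ->
  #|colored f| + 4 * size c + 20 <= M -> bob_wins Bob f.
Proof.
case: c => [|y1 rest] // e_c u_c sp bl ev sz fy le_M.
have [sy sy1 srest] : [/\ spine y, spine y1 & all spine rest].
  by move: sp => /= /and3P[].
have [iy1 fy1] : inner y1 /\ f y1 = None.
  by apply: (blank_onP bl); rewrite !inE eqxx orbT.
move: e_c; rewrite /= rcons_path => /and3P[yy1 e_rest e_last].
move: (u_c); rewrite /= !inE !negb_or.
case/and3P=> /andP[nyy1 yrest] y1rest u_rest.
have [y2 [r Er]] : exists y2 r, rest = y2 :: r.
  by case: (rest) sz => // y2 r _; exists y2, r.
have e_rot : path (@edge G) y1 (rcons rest y) by rewrite rcons_path e_rest.
have e_rot' : sorted (@edge G) (rcons rest y).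
  by move: e_rot; rewrite Er /= => /andP[].
have yy : edge y1 y by rewrite edge_sym.
apply: (bob_round (a := a) iy1 fy1); first by clear -le_M; lia.
move=> x g f1 A1; have le1 := after_card A1.
have fy' := after_forb A1 fy; have fy1' := after_add A1.
have sub (s : seq G) : {subset s <= y :: y1 :: rest} -> x \notin s ->
    blank_on f1 s.
  by move=> su xs; apply: (after_blank_on A1) => //; exact: blank_on_sub bl.
have [xy|xy] := eqVneq x y.
  subst x; apply: (@bob_wins_path _ (y1 :: rest) y f1 a g g (leqnn _)) => //.
  - by rewrite /= y1rest.
  - by apply: sub; [sub_seq | rewrite inE negb_or nyy1].
  - by rewrite eq_sym; exact: (after_new A1).
  - exact: after_nbr A1 _ yy1.
  - by apply: (after_nbr A1); rewrite edge_sym.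
  - by rewrite eqxx orbT ev.
  - by clear -le1 le_M; lia.
have [xy1|xy1] := eqVneq x y1.
  subst x; apply: (@bob_wins_path _ (rev (rcons rest y)) y f1 a g g (leqnn _)).
  - by rewrite -size_eq0 size_rev size_rcons.
  - exact: sorted_rev_edge.
  - by rewrite rev_uniq rcons_uniq yrest.
  - apply: sub; first by move=> w; rewrite mem_rev mem_rcons; sub_in.
    by rewrite mem_rev mem_rcons inE negb_or xy.
  - by rewrite eq_sym; exact: (after_newv A1).
  - by rewrite head_rev last_rcons.
  - by rewrite head_rev last_rcons; exact: (after_nbr A1).
  - rewrite last_rev Er /=; apply: (after_nbr A1).
    by move: e_rest; rewrite Er /= => /andP[].
  - by rewrite eqxx orbT size_rev size_rcons ev.
  - by rewrite size_rev size_rcons; move: le_M => /=; clear -le1; lia.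
have [xr|xr] := boolP (x \in rest); last first.
  have xc : x \notin y :: y1 :: rest by rewrite !inE !negb_or xy xy1.
  have bl1 : blank_on f1 (y :: y1 :: rest) by exact: sub.
  have e12 : edge y1 y2 by move: e_rest; rewrite Er => /andP[].
  have uq3 : uniq [:: y; y1; y2].
    move: yrest y1rest; rewrite Er /= !inE !negb_or nyy1.
    by move=> /andP[-> _] /andP[-> _].
  apply: (@bob_extends_run f1 y y1 y2 a) => //.
  - by move: srest; rewrite Er /= sy sy1 => /andP[->].
  - by apply: blank_on_sub bl1 => w; rewrite Er; sub_in.
  - by clear -le1 le_M sz; lia.
  move=> g2 f2 A2; have le2 := after_card A2.
  apply: (@bob_wins_path _ (rcons rest y) y f2 a g2 a (leqnn _)).
  - by rewrite Er.
  - by [].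
  - by rewrite rcons_uniq yrest.
  - apply: (after_blank_on A2).
      by rewrite mem_rcons inE negb_or eq_sym nyy1.
    by apply: blank_on_sub bl1 => w; rewrite mem_rcons; sub_in.
  - by rewrite eq_sym; exact: (after_new A2).
  - by rewrite Er /=; exact: after_add A2.
  - by rewrite Er /=; exact: (after_nbr A2).
  - by rewrite last_rcons; exact: after_forb A2 _ _ fy'.
  - by rewrite eqxx size_rcons ev.
  - by rewrite size_rcons; move: le_M => /=; clear -le1 le2; lia.
have [r1 [r2 E12]] : exists r1 r2, rest = r1 ++ x :: r2.
  by case/splitPr: xr => r1 r2; exists r1, r2.
have szE : size rest = size r1 + (size r2).+1 by rewrite E12 size_cat.
have [xr1 xr2] : x \notin r1 /\ x \notin r2.
  move: u_rest; rewrite E12 uniq_catC /= mem_cat negb_or.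
  by case/andP => /andP[].
have sub1 : {subset r1 <= rest} by move=> w wr; rewrite E12 mem_cat wr.
have sub2 : {subset r2 <= rest}.
  by move=> w wr; rewrite E12 mem_cat inE wr !orbT.
have e2 : path (@edge G) x (rcons r2 y).
  move: e_rot; rewrite E12 rcons_cat cat_path /=.
  by case/and3P.
have e2' : sorted (@edge G) (rcons r2 y).
  by move: e2; case: (rcons r2 y) => //= w p /andP[].
have x2 : edge x (head y (rcons r2 y)).
  by move: e2; case: (r2) => [|w p] /= /andP[].
have u2 : uniq (rcons r2 y).
  rewrite rcons_uniq; have /negPf yr := yrest.
  rewrite (contraFN (@sub2 y) yr) /=.
  by move: u_rest; rewrite E12 cat_uniq /= => /and4P[].
(* If Alice colored the vertex following [y1], the run grows on the other side of [y], and [y] is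
   the vertex she has to color. The two paths are then [y1] alone and [r2]. *)
have [E1|n1] := eqVneq r1 [::].
  have [t [r3 E3]] : exists t r3, r2 = rcons r3 t.
    move: szE sz; rewrite E1 /=; case/lastP: (r2) => [->|r3 t _ _] //.
    by exists t, r3.
  have et : edge t y.
    by move: e2; rewrite E3 !rcons_path last_rcons => /andP[].
  have et' : edge y t by rewrite edge_sym.
  have e1x : edge y1 x by move: e_rest; rewrite E12 E1 /= => /andP[].
  have tr2 : t \in r2 by rewrite E3 mem_rcons mem_head.
  have tr := sub2 _ tr2.
  apply: (@bob_extends_run f1 y1 y t a) => //.
  - rewrite /= !inE !negb_or eq_sym nyy1 /= andbT.
    by apply/andP; split; apply: contraTneq tr => <-.
  - by rewrite /= sy sy1 (allP srest).
  - apply: sub => [w|].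
      by rewrite !inE => /or3P[] /eqP ->; rewrite ?eqxx ?tr ?orbT.
    by rewrite !inE !negb_or xy xy1; apply: contraNneq xr2 => ->.
  - by clear -le1 le_M sz; lia.
  move=> g2 f2 A2; have le2 := after_card A2.
  have ag2 : a != g2 by rewrite eq_sym; exact: (after_new A2).
  have fy12 := after_forb A2 fy1'.
  have fy1g2 : forb f2 y1 g2 by exact: (after_nbr A2).
  have fy1g : forb f2 y1 g.
    by apply: (after_forb A2); apply: (after_nbr A1); rewrite edge_sym.
  have [g_in|g_out] := boolP ((g == a) || (g == g2)); last first.
    apply: (@bob_wins_path _ [:: y1] y f2 a g2 g (leqnn _)) => //.
    - apply: (after_blank_on A2); first by rewrite inE.
      by apply: sub; [sub_seq | rewrite inE].
    - exact/negbTE.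
    - by move: le_M => /=; clear -le1 le2; lia.
  apply: (@bob_wins_path _ (rev r2) y f2 a g2 g (leqnn _)) => //.
  - by rewrite -size_eq0 size_rev E3 size_rcons.
  - apply: sorted_rev_edge; move: e2'.
    by case: (r2) => //= w p; rewrite rcons_path => /andP[].
  - by move: u2; rewrite rev_uniq rcons_uniq => /andP[].
  - apply: (after_blank_on A2).
      by rewrite mem_rev; apply: contra yrest => /sub2.
    apply: sub; rewrite ?mem_rev // => w; rewrite mem_rev => /sub2 wr.
    by rewrite !inE wr !orbT.
  - by rewrite head_rev E3 last_rcons; exact: after_add A2.
  - by rewrite head_rev E3 last_rcons; exact: (after_nbr A2 et').
  - rewrite last_rev; apply: (after_forb A2); apply: (after_nbr A1).
    by move: x2; rewrite E3; case: (r3).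
  - rewrite g_in size_rev; move: szE ev; rewrite E1 /= => -> /=.
    by rewrite negbK.
  - by rewrite size_rev; move: le_M szE => /=; clear -le1 le2; lia.
have [r1' E1'] : exists r1', r1 = y2 :: r1'.
  by case: (r1) n1 E12 => // w p _; rewrite Er => -[<- _]; exists p.
have e12 : edge y1 y2 by move: e_rest; rewrite Er => /andP[].
have y2r : y2 \in rest by rewrite Er mem_head.
have e1 : path (@edge G) y1 (rcons r1 x).
  by move: e_rest; rewrite E12 -cat_rcons cat_path => /andP[].
apply: (@bob_extends_run f1 y y1 y2 a) => //.
- rewrite /= !inE !negb_or nyy1 /= andbT.
  by apply/andP; split; apply: contraTneq y2r => <-.
- by rewrite /= sy sy1 (allP srest).
- apply: sub => [w|]; first by rewrite Er; sub_in.
  rewrite !inE !negb_or xy xy1; apply: contraNneq xr1 => ->.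
  by rewrite E1' mem_head.
- by clear -le1 le_M sz; lia.
move=> g2 f2 A2; have le2 := after_card A2.
have ag2 : a != g2 by rewrite eq_sym; exact: (after_new A2).
have y1nr s : {subset s <= rest} -> y1 \notin s.
  by move=> ss; apply: contra y1rest => /ss.
(* The two paths are [r1], and [r2] followed by [y]. Each has [a], [g2] forbidden at one end and [g]
   at the other, and their sizes have an odd sum, so exactly one of them has the right parity. *)
have [par|npar] := eqVneq ((g == a) || (g == g2)) (~~ odd (size r1)).
  apply: (@bob_wins_path _ r1 y f2 a g2 g (leqnn _)) => //.
  - by move: e1; rewrite E1' /= rcons_path => /and3P[].
  - by move: u_rest; rewrite E12 cat_uniq => /and3P[].
  - apply: (after_blank_on A2); first exact: y1nr.
    by apply: sub => // w /sub1 wr; rewrite !inE wr !orbT.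
  - by rewrite E1' /=; exact: after_add A2.
  - by rewrite E1' /=; exact: (after_nbr A2).
  - apply: (after_forb A2); apply: (after_nbr A1); rewrite edge_sym.
    by move: e1; rewrite E1' /= rcons_path => /and3P[].
  - by move: le_M szE => /=; clear -le1 le2; lia.
apply: (@bob_wins_path _ (rev (rcons r2 y)) y f2 a g2 g (leqnn _)) => //.
- by rewrite -size_eq0 size_rev size_rcons.
- exact: sorted_rev_edge.
- by rewrite rev_uniq.
- apply: (after_blank_on A2).
    by rewrite mem_rev mem_rcons inE negb_or eq_sym nyy1 y1nr.
  apply: sub => [w|]; last by rewrite mem_rev mem_rcons inE negb_or xy.
  rewrite mem_rev mem_rcons inE => /orP[/eqP->|/sub2 wr].
    by rewrite mem_head.
  by rewrite !inE wr !orbT.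
- by rewrite head_rev last_rcons; exact: (after_forb A2).
- by rewrite head_rev last_rcons; exact: (after_nbr A2).
- rewrite last_rev; apply: (after_forb A2); exact: (after_nbr A1).
- rewrite size_rev size_rcons /=; move: ev npar; rewrite /= szE oddD /=.
  by case: (_ || _); do 2 case: odd.
- by rewrite size_rev size_rcons; move: le_M szE => /=; clear -le1 le2; lia.
Qed.

(* Once Bob has spoiled [y], Alice has to answer on the cycle itself. *)
Lemma bob_attacks_cycle f (c : seq G) y : cycle (@edge G) (y :: c) ->
  uniq (y :: c) -> all spine (y :: c) -> blank_on f (y :: c) ->
  ~~ odd (size c) -> 3 < size c -> #|colored f| + 4 * size c + 22 <= M ->
  (forall x g f', x \in y :: c -> after f y ord0 x g f' -> bob_wins Bob f') ->
  bob_wins Bob f.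
Proof.
move=> e_c u_c sp bl ev sz le_M next.
have [iy fy] : inner y /\ f y = None by exact: (blank_onP bl (mem_head _ _)).
apply: (bob_round (a := ord0) iy fy); first by clear -le_M; lia.
move=> x g f' A; have [xc|xc] := boolP (x \in y :: c).
  exact: (next x g f').
apply: (bob_wins_cycle e_c u_c sp _ ev sz (after_add A)).
  exact: (after_blank_on A).
by have := after_card A; clear -le_M; lia.
Qed.

(* Whatever the two colors forbidden at [v], one of the two routes through
   [A] has the parity required by [bob_wins_path]. *)
Definition live f (A : seq G) v := exists c (q : bool -> seq G), forall b,
  [/\ path (@edge G) v (q b), uniq (q b), {subset q b <= A} &
    blank_on f (q b) /\ odd (size (q b)) = b /\ forb f (last v (q b)) c].

Lemma live_after f v a x g f' A w : after f v a x g f' -> x \notin A ->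
  live f A w -> live f' A w.
Proof.
move=> H xA [c [q Hq]]; exists c, q => b; have [? ? sub [bl [? ?]]] := Hq b.
split=> //; split; last by split=> //; exact: (after_forb H).
by apply: (after_blank_on H) => //; apply: contra xA; exact: sub.
Qed.

Lemma live_bob_wins f (A : seq G) v a b : live f A v -> v \notin A ->
  inner v -> f v = None -> a != b -> forb f v a -> forb f v b ->
  #|colored f| + 4 * (size A).+1 <= M -> bob_wins Bob f.
Proof.
move=> [c [q Hq]] vA iv fv ab fa fb le_M.
have [e_q u_q sub [bl [par fc]]] := Hq ((c == a) || (c == b)).
have le_q := uniq_leq_size u_q sub.
apply: (@bob_wins_path _ (v :: q ((c == a) || (c == b))) v f a b c) => //=.
- by rewrite u_q andbT; apply: contra vA; exact: sub.
- by rewrite iv fv eqxx.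
- by rewrite par negbK.
- by apply: leq_trans le_M; rewrite leq_add2l leq_mul2l ltnS.
Qed.

(** * Four consecutive vertices with four arms each *)

Section Armed.
Variables (main : 'I_4 -> G) (arm : 'I_4 -> 'I_4 -> seq G) (N : nat).
Hypothesis main_inj : injective main.
Hypothesis main_spine : forall i, spine (main i).
Hypothesis edge_main : forall i i' : 'I_4, i' = i.+1 :> nat ->
  edge (main i) (main i').
Hypothesis main_arm : forall i i' j, main i \notin arm i' j.
Hypothesis arm_disj : forall i j i' j' x, x \in arm i j -> x \in arm i' j' ->
  (i, j) = (i', j').
Hypothesis size_arm : forall i j, size (arm i j) < N.

(** [X] collects the vertices colored by Alice after the arms became live; nothing is claimed about
    an arm that meets [X]. *)
Definition armed f (X : seq G) := forall i j, (forall x, x \in X ->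
  x \notin arm i j) -> live f (arm i j) (main i).

Lemma armed_after f v a x g f' X : after f v a x g f' -> armed f X ->
  armed f' (x :: X).
Proof.
move=> H fX i j Xij; apply: (live_after H); first by rewrite Xij ?mem_head.
by apply: fX => y yX; apply: Xij; rewrite inE yX orbT.
Qed.

(** The arms are disjoint, so each vertex of [X] spoils at most one of the four arms at [main i];
    fewer than four such vertices leave a live one. *)
Lemma armed_bob_wins f X i a b : armed f X -> size X < 4 ->
  f (main i) = None -> a != b -> forb f (main i) a -> forb f (main i) b ->
  #|colored f| + 4 * N <= M -> bob_wins Bob f.
Proof.
move=> fX X4 fi ab fa fb le_M.
have [j Xj] : exists j, forall x, x \in X -> x \notin arm i j.
  (* Each vertex of [X] is sent to the arm of row [i] that it spoils. The default [ord0] for the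
     others is harmless, since only the number of values counts. *)
  have /subsetPn[j _ jX] : ~~ ([set: 'I_4] \subset
      [seq odflt ord0 [pick j | x \in arm i j] | x <- X]).
    apply: contraL X4 => /subset_leq_card; rewrite cardsT card_ord => le.
    rewrite -leqNgt (leq_trans le) // (leq_trans (card_size _)) //.
    by rewrite size_map.
  exists j => x xX; apply: contra jX => xj; apply/mapP; exists x => //.
  case: pickP => [j' xj'|/(_ j)]; last by rewrite xj.
  by case: (arm_disj xj xj').
apply: (live_bob_wins (fX i j Xj) (main_arm _ _ _) _ fi ab fa fb).
  exact/spine_inner/main_spine.
by have := size_arm i j; clear -le_M; lia.
Qed.

(** Bob forbids [g] at [main i'] and then a second color at [main i]. Coloring one of the two
    vertices gives the other a second forbidden color, and other replies end with two at [main i].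
    Alice has at most three vertices in [X] by then, which four arms tolerate. *)
Lemma armed_pair f X i i' g : armed f X -> size X <= 1 ->
  edge (main i) (main i') -> f (main i) = None -> f (main i') = None ->
  forb f (main i) g -> #|colored f| + 4 + 4 * N <= M -> bob_wins Bob f.
Proof.
move=> fX X1 e_ii fi fi' fg le_M.
have im j : inner (main j) by exact/spine_inner/main_spine.
have X2 y : size (y :: X) < 4 by rewrite /=; clear -X1; lia.
have X3 y z : size [:: y, z & X] < 4 by rewrite /=; clear -X1; lia.
have N0 : 0 < N by exact: leq_ltn_trans (size_arm i ord0).
apply: (bob_round (a := g) (im i') fi'); first by clear -le_M N0; lia.
move=> x h f1 A1; have le1 := after_card A1; have fX1 := armed_after A1 fX.
have [xi|xi] := eqVneq x (main i).
  subst x; apply: (@armed_bob_wins f1 _ i' g h fX1) => //.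
  - rewrite (after_inner A1) //; apply: contraTneq e_ii => ->.
    by rewrite edge_irr.
  - by rewrite eq_sym; exact: (after_new A1).
  - exact: after_add A1.
  - exact: (after_nbr A1).
  - by clear -le1 le_M; lia.
have fi1 : f1 (main i) = None by rewrite (after_inner A1) // eq_sym.
have fg1 := after_forb A1 fg; have fg1' := after_add A1.
have [xi'|xi'] := eqVneq x (main i').
  subst x; apply: (@armed_bob_wins f1 _ i g h fX1) => //.
  - by rewrite eq_sym; exact: (after_newv A1).
  - by apply: (after_nbr A1); rewrite edge_sym.
  - by clear -le1 le_M; lia.
have fi1' : f1 (main i') = None by rewrite (after_inner A1) // eq_sym.
have [b gb] := other_color g.
apply: (bob_round (a := b) (im i) fi1); first by clear -le1 le_M N0; lia.
move=> y h' f2 A2; have le2 := after_card A2; have fX2 := armed_after A2 fX1.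
have [yi|yi] := eqVneq y (main i).
  subst y; apply: (@armed_bob_wins f2 _ i' g h' fX2) => //.
  - rewrite (after_inner A2) //; apply: contraTneq e_ii => ->.
    by rewrite edge_irr.
  - by rewrite eq_sym; exact: (after_new A2).
  - exact: (after_forb A2).
  - exact: (after_nbr A2).
  - by clear -le1 le2 le_M; lia.
apply: (@armed_bob_wins f2 _ i g b fX2) => //.
- by rewrite (after_inner A2) // eq_sym.
- exact: (after_forb A2).
- exact: after_add A2.
- by clear -le1 le2 le_M; lia.
Qed.

(** Bob opens at vertex 1 of the path 0, 1, 2, 3. An uncolored adjacent pair with a forbidden color
    at its first vertex remains: 2 and 3 if Alice colors 1, 1 and 2 if she colors 0, 1 and 0
    otherwise. *)
Lemma armed_path_bob_wins f : armed f [::] -> (forall i, f (main i) = None) ->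
  #|colored f| + 6 + 4 * N <= M -> bob_wins Bob f.
Proof.
move=> f0 fm le_M.
pose o n : 'I_4 := inord n.
have oE n : n < 4 -> o n = n :> nat by move=> n4; rewrite inordK.
have e_o n : n < 3 -> edge (main (o n)) (main (o n.+1)).
  by move=> n3; apply: edge_main; rewrite !oE // ltnW.
have e_o' n : n < 3 -> edge (main (o n.+1)) (main (o n)).
  by move=> n3; rewrite edge_sym; exact: e_o.
have ne n p : n < 4 -> p < 4 -> n != p -> main (o n) != main (o p).
  move=> n4 p4; apply: contra => /eqP /main_inj /(congr1 val).
  by rewrite /= !oE // => ->.
have im j : inner (main j) by exact/spine_inner/main_spine.
apply: (bob_round (a := ord0) (im (o 1)) (fm _)); first by clear -le_M; lia.
move=> x g f1 A1; have le1 := after_card A1; have fX1 := armed_after A1 f0.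
have le_M1 : #|colored f1| + 4 + 4 * N <= M by clear -le1 le_M; lia.
have other n : n < 4 -> x != main (o n) -> f1 (main (o n)) = None.
  by move=> n4 xn; rewrite (after_inner A1) // eq_sym.
have [x1|x1] := eqVneq x (main (o 1)).
  subst x; apply: (armed_pair fX1 _ (e_o 2 _) _ _ (g := g)) => //.
  - by apply: other => //; exact: ne.
  - by apply: other => //; exact: ne.
  - by apply: (after_nbr A1); exact: e_o.
have [x0|x0] := eqVneq x (main (o 0)).
  subst x; apply: (armed_pair fX1 _ (e_o 1 _) _ _ (after_add A1)) => //.
  - by apply: other => //; exact: ne.
  - by apply: other => //; exact: ne.
by apply: (armed_pair fX1 _ (e_o' 0 _) _ _ (after_add A1)) => //; exact: other.
Qed.

Variables (top : 'I_4 -> 'I_4 -> G) (loop : 'I_4 -> 'I_4 -> seq G).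
Hypothesis loop_cycle : forall i j, cycle (@edge G) (top i j :: loop i j).
Hypothesis loop_uniq : forall i j, uniq (top i j :: loop i j).
Hypothesis loop_odd : forall i j, ~~ odd (size (loop i j)).
Hypothesis loop_size : forall i j, 3 < size (loop i j) < N.
Hypothesis loop_arm : forall i j, {subset top i j :: loop i j <= arm i j}.
Hypothesis arm_spine : forall i j, all spine (arm i j).
Hypothesis loop_live : forall f i j x c, x \in top i j :: loop i j ->
  (forall w, w \in arm i j -> w != x -> f w = None) ->
  (forall w, edge x w -> forb f w c) -> live f (arm i j) (main i).

(** Bob attacks the loops of the sixteen arms in turn. Each attack forces a reply on that loop,
    which makes this arm live and touches no other arm and no [main] vertex. The sixteen rounds
    color 32 vertices; the other 28 units of the constant cover the last attack and the final
    phase. *)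
Lemma bob_wins_arms f : (forall i, f (main i) = None) ->
  (forall i j, blank_on f (arm i j)) ->
  #|colored f| + 60 + 4 * N <= M -> bob_wins Bob f.
Proof.
move=> fm fa le_M; pose all_arms := enum [set: 'I_4 * 'I_4].
have : forall ij, ij \in all_arms -> blank_on f (arm ij.1 ij.2) by [].
have : forall ij, ij \notin all_arms -> live f (arm ij.1 ij.2) (main ij.1).
  by move=> ij; rewrite mem_enum inE.
have : #|colored f| + 2 * size all_arms + 28 + 4 * N <= M.
  rewrite /all_arms -cardE cardsT card_prod card_ord.
  by clear -le_M; lia.
have : uniq all_arms by exact: enum_uniq.
elim: all_arms f fm {fa le_M} => [|[i j] todo IH] f fm.
  move=> _ le_M f_live _; apply: armed_path_bob_wins => //.
    by move=> i j _; exact: (f_live (i, j)).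
  by move: le_M; rewrite muln0 addn0; clear; lia.
move=> /= /andP[nij u_todo] le_M f_live f_blank.
have bl := f_blank _ (mem_head _ _); rewrite /= in bl.
apply: (bob_attacks_cycle (loop_cycle i j) (loop_uniq i j)) => //.
- by apply/allP => w /loop_arm; exact: (allP (arm_spine i j)).
- by apply: blank_on_sub bl; exact: loop_arm.
- by case/andP: (loop_size i j).
- by have /andP[_] := loop_size i j; move: (size (loop i j)) le_M; clear; lia.
move=> x g f' xc A; have le1 := after_card A.
have xa := loop_arm xc.
have out i' j' : (i', j') != (i, j) -> x \notin arm i' j'.
  by apply: contra => xa'; apply/eqP; exact: arm_disj xa' xa.
have im i' : inner (main i') by exact/spine_inner/main_spine.
apply: IH => //.
- move=> i'; rewrite (after_inner A) //.
  by apply: contraNneq (main_arm i' i j) => ->.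
- by move: le_M => /=; clear -le1; lia.
- move=> [i' j'] nt; have [E|ne] := eqVneq (i', j') (i, j).
    case: E => -> ->; apply: (loop_live xc _ (after_nbr A)).
    move=> w wa wx; have [iw fw] := blank_onP bl wa.
    by rewrite (after_inner A).
  apply: (live_after A); first exact: out.
  by apply: f_live; rewrite inE negb_or ne.
- move=> [i' j'] ij'; apply: (after_blank_on A).
    by apply: out; apply: contraNneq nij => <-.
  by apply: f_blank; rewrite inE ij' orbT.
Qed.

End Armed.

End FewColors.

(** * Alice's strategy *)

Section RootedForest.
Variables (T : finType) (up anc : rel T) (dep : T -> nat).

(* [up x y]: the parent of [x] is [y]; [anc x y]: [x] is [y] or one of its
   ancestors. *)
Record rooted_forest : Prop := RootedForest {
  up_fun : forall x y z, up x y -> up x z -> y = z;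
  up_dep : forall x y, up x y -> dep y < dep x;
  anc_refl : forall x, anc x x;
  anc_up : forall x y z, up y z -> x != y -> anc x y = anc x z;
  anc_neq : forall x y, anc x y -> x != y -> exists z, up y z }.

Hypothesis F : rooted_forest.

Lemma anc_ind y (P : T -> Prop) : P y ->
  (forall z w, up z w -> P w -> P z) -> forall z, anc y z -> P z.
Proof.
move=> Py step z; have [n] := ubnP (dep z); elim: n => // n IH in z *.
have [<- //|ne] := eqVneq y z; move=> lt_n yz.
have [w zw] := anc_neq F yz ne; apply: (step z w zw); apply: IH.
  by have := up_dep F zw; move: lt_n; clear; lia.
by rewrite -(anc_up F zw ne).
Qed.

Lemma anc_dep x y : anc x y -> dep x <= dep y.
Proof.
move: y; apply: anc_ind => // z w zw; have := up_dep F zw; clear; lia.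
Qed.

Lemma anc_parent x y z : up x y -> anc x z -> anc y z.
Proof.
move=> xy; have step u w : up u w -> anc y w -> anc y u.
  move=> uw; have [->|ne] := eqVneq y u; first by rewrite anc_refl.
  by rewrite (anc_up F uw ne).
by move: z; apply: anc_ind => //; exact: (step x y xy (anc_refl F y)).
Qed.

Lemma anc_trans x y z : anc x y -> anc y z -> anc x z.
Proof.
move=> xy; move: z; apply: anc_ind => // u w uw xw.
have [->|ne] := eqVneq x u; first exact: (anc_refl F).
by rewrite (anc_up F uw ne).
Qed.

Lemma anc_total x y z : anc x z -> anc y z -> anc x y \/ anc y x.
Proof.
have [n] := ubnP (dep z); elim: n => // n IH in z *; move=> lt_n xz yz.
have [->|nx] := eqVneq x z; first by right.
have [->|ny] := eqVneq y z; first by left.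
have [w zw] := anc_neq F xz nx; apply: (IH w).
- by have := up_dep F zw; move: lt_n; clear; lia.
- by rewrite -(anc_up F zw nx).
- by rewrite -(anc_up F zw ny).
Qed.

(** Two ancestors of [z] are comparable, whereas distinct children of [v] are not: the upper one
    would be an ancestor of [v], against the depths. *)
Lemma anc_child_uniq x y v z : up x v -> up y v -> anc x z -> anc y z -> x = y.
Proof.
wlog xy : x y / anc x y => [H xv yv xz yz|xv yv _ _].
  by have [xy|yx] := anc_total xz yz; [exact: H | symmetry; exact: H].
apply/eqP; apply: contraTT xy => ne; rewrite (anc_up F yv ne).
by apply: contraL (up_dep F xv) => /anc_dep; rewrite -leqNgt.
Qed.

End RootedForest.

(** * Alice's strategy and its invariants *)

Section AliceStrategy.
Variables (G : sgraph) (up anc : rel G) (dep : G -> nat).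
Variable mate : G -> option G.
Hypothesis F : rooted_forest up anc dep.
Hypothesis edge_up : forall x y : G, edge x y ->
  [|| up x y, up y x | mate x == Some y].
Implicit Types f : coloring G 5.

Definition active f x := [exists w, (f w != None) && anc x w].
Definition active_children f v := [set c | up c v && active f c].

(** An uncolored vertex with two active children is urgent. When there is none, least depth ensures
    that all proper ancestors of the target are colored. *)
Definition target f : option G :=
  if [pick v | (f v == None) && (1 < #|active_children f v|)] is Some v
  then Some v
  else [pick v | (f v == None)
          && [forall w, (f w == None) ==> (dep v <= dep w)]].

Definition alice_strategy : strategy G 5 := fun f =>
  if target f is Some v then [pick m | legal f m && (m.1 == v)] else None.

Lemma active_play f m x : active (play f m) x -> active f x || anc x m.1.
Proof.
case/existsP => w /andP[fw xw]; move: fw; rewrite /play ffunE.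
have [<- _|_ fw] := eqVneq w m.1; first by rewrite xw orbT.
by apply/orP; left; apply/existsP; exists w; rewrite fw.
Qed.

(** A child that becomes active is an ancestor of the vertex just colored, and [v] has at most one
    such child. *)
Lemma children_play f m v : #|active_children (play f m) v| <=
  #|active_children f v| + [exists c, (c \in active_children (play f m) v)
                              && ~~ active f c].
Proof.
have [/existsP[c /andP[cv nc]]|nex] :=
  boolP [exists c, (c \in active_children (play f m) v) && ~~ active f c].
  rewrite addn1.
  have: active_children (play f m) v \subset c |: active_children f v.
    apply/subsetP => d; rewrite !inE => /andP[dv dm]; rewrite dv /=.
    have := active_play dm; case: (active f d) => /=; first by rewrite orbT.
    move=> da; rewrite orbF; apply/eqP; apply: (anc_child_uniq F dv _ da).
      by move: cv; rewrite inE => /andP[].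
    by move: cv; rewrite inE => /andP[_ /active_play]; rewrite (negPf nc).
  move/subset_leq_card/leq_trans; apply; rewrite cardsU1.
  by rewrite -add1n leq_add2r leq_b1.
rewrite addn0; apply: subset_leq_card; apply/subsetP => d dm.
move: (dm); rewrite !inE => /andP[-> _] /=; apply: contraR nex => nd.
by apply/existsP; exists d; rewrite dm.
Qed.

(** A colored neighbor of [v] is an active child, the parent or the mate: at most four vertices
    against five colors. *)
Lemma legal_color f v : f v = None -> #|active_children f v| <= 2 ->
  exists m, legal f m && (m.1 == v).
Proof.
move=> fv le2; pose used := [set c | [exists w, edge v w && (f w == Some c)]].
pose N := active_children f v :|: [set y | up v y]
    :|: [set y | mate v == Some y].
have N4 : #|N| <= 4.
  have up1 : #|[set y | up v y]| <= 1.
    apply/card_le1_eqP => y z; rewrite !inE => vy vz.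
    exact: (up_fun F vz vy).
  have mate1 : #|[set y | mate v == Some y]| <= 1.
    apply/card_le1_eqP => y z; rewrite !inE => /eqP -> /eqP [->] //.
  have U1 := cardsU (active_children f v) [set y | up v y].
  have U2 := cardsU (active_children f v :|: [set y | up v y])
                    [set y | mate v == Some y].
  rewrite -/N in U2; move: le2 up1 mate1 U1 U2; clear; lia.
have sub : used \subset [set odflt ord0 (f w) | w in N].
  apply/subsetP => c; rewrite inE => /existsP[w /andP[vw /eqP fw]].
  apply/imsetP; exists w; rewrite ?fw // !inE.
  case/or3P: (edge_up vw) => ->; rewrite ?orbT //=.
  have -> // : active f w.
  by apply/existsP; exists w; rewrite fw (anc_refl F).
have [c nc] : exists c, c \notin used.
  have /subsetPn[c _ nc] : ~~ ([set: 'I_5] \subset used).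
    apply: contraL N4 => /subset_leq_card; rewrite cardsT card_ord => le5.
    rewrite -ltnNge (leq_trans le5) // (leq_trans (subset_leq_card sub)) //.
    exact: leq_imset_card.
  by exists c.
exists (v, c); rewrite eqxx andbT /legal /= fv eqxx /=.
apply/forallP => w; apply/implyP => vw; apply: contra nc => fw.
by rewrite inE; apply/existsP; exists w; rewrite vw.
Qed.

Definition alice_inv f :=
  (forall v, f v = None -> #|active_children f v| <= 2) /\
  forall v w, f v = None -> f w = None -> 1 < #|active_children f v| ->
    1 < #|active_children f w| -> v = w.

Definition bob_inv f :=
  forall v, f v = None -> #|active_children f v| <= 1.

Lemma play_None f m v : play f m v = None -> f v = None /\ v != m.1.
Proof. by rewrite /play ffunE; case: eqP. Qed.

(** Bob cannot create two urgent vertices. The newly active children [c] and [c'] are both ancestors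
    of his vertex, hence comparable; if they differ, the upper one lies above the parent of the
    lower one, which had an active child before, so the upper one was active already. *)
Lemma bob_inv_play f m : bob_inv f -> legal f m -> alice_inv (play f m).
Proof.
move=> inv lm; split=> [v /play_None[fv _]|].
  apply: leq_trans (children_play f m v) _; have := inv v fv.
  by case: [exists _, _]; clear; lia.
have newc v : f v = None -> 1 < #|active_children (play f m) v| ->
    exists c d, [/\ up c v, anc c m.1, ~~ active f c & up d v && active f d].
  move=> fv gt1; have := leq_trans gt1 (children_play f m v).
  have := inv v fv; case: existsP => [[c /andP[cv nc]]|_]; last first.
    by clear; lia.
  move=> le1 le2; have /card_gt0P[d dv] : 0 < #|active_children f v|.
    by move: le2; clear; lia.
  exists c, d; move: cv dv; rewrite !inE => /andP[-> /active_play].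
  by rewrite (negPf nc).
move=> v w /play_None[fv _] /play_None[fw _] v1 w1.
have [c [d [cv cm nc /andP[dv ad]]]] := newc v fv v1.
have [c' [d' [cw cm' nc' /andP[dw ad']]]] := newc w fw w1.
have up_active x y z : up y x -> active f y -> anc z x -> active f z.
  move=> yx /existsP[u /andP[fu yu]] zx; apply/existsP; exists u.
  by rewrite fu (anc_trans F zx) // (anc_parent F yx).
have [cc|cc] := anc_total F cm cm'; have [E|ne] := eqVneq c c'.
- by rewrite -E in cw; exact: (up_fun F cv cw).
- by move: cc nc; rewrite (anc_up F cw ne) => /(up_active _ _ _ dw ad') ->.
- by rewrite -E in cw; exact: (up_fun F cv cw).
- move: cc nc'; rewrite (anc_up F cv) 1?eq_sym //.
  by move=> /(up_active _ _ _ dv ad) ->.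
Qed.

(** No uncolored vertex gains an active child. An urgent target has an active child, so it and all
    its ancestors were active before. For a target of least depth, the parent of a newly active
    child would be an uncolored vertex of smaller depth. *)
Lemma alice_inv_play f v m : alice_inv f -> target f = Some v ->
  m.1 = v -> bob_inv (play f m).
Proof.
case=> inv2 inv1 tf mv u /play_None[fu]; rewrite mv => uv.
have le1 : ~~ [exists c, (c \in active_children (play f m) u)
    && ~~ active f c] -> #|active_children f u| <= 1 ->
    #|active_children (play f m) u| <= 1.
  move=> /negPf E; have := children_play f m u; rewrite E addn0.
  exact: leq_trans.
move: tf; rewrite /target; case: pickP => [v' /andP[/eqP fv v1] [E]|no1].
  subst v'; apply: le1; last first.
    by rewrite leqNgt; apply: contraNN uv => u1; apply/eqP; exact: inv1.
  apply/existsPn => c; rewrite negb_and negbK inE orbC -implyNb; apply/implyP.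
  move=> nc; apply/negP => /andP[_ /active_play].
  rewrite (negPf nc) mv /= => cv.
  have /card_gt0P[d] : 0 < #|active_children f v| by exact: ltnW.
  rewrite inE => /andP[dv /existsP[w /andP[fw dw]]]; case/existsP: nc.
  by exists w; rewrite fw (anc_trans F cv) // (anc_parent F dv).
case: pickP => // v' /andP[_ /forallP vmin] [E]; subst v'.
apply: le1; last first.
  by have := no1 u; rewrite fu eqxx /= => /negbT; rewrite -leqNgt.
apply/existsPn => c; rewrite negb_and negbK inE orbC -implyNb; apply/implyP.
move=> nc; apply/negP => /andP[cu /active_play]; rewrite (negPf nc) mv /= => cv.
have := vmin u; rewrite fu eqxx /= leqNgt.
by rewrite (leq_trans (up_dep F cu)) // (anc_dep F cv).
Qed.

Lemma alice_wins5 : alice_wins G 5.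
Proof.
have inv t f : reached alice_strategy t f ->
    match t with Alice => alice_inv f | Bob => bob_inv f end.
  elim=> {t f} [|f m _ inv sm lm|f m _ inv lm]; last exact: bob_inv_play.
    have E v : #|active_children (blank G 5) v| = 0.
      apply: eq_card0 => c; rewrite !inE; apply: negbTE; rewrite negb_and.
      by apply/orP; right; apply/existsPn => w; rewrite ffunE.
    by split=> [v _|v w _ _]; rewrite E.
  move: sm; rewrite /alice_strategy; case tf: (target f) => [v|] //.
  case: pickP => // m' /andP[_ /eqP m'v] [E]; subst m'.
  exact: alice_inv_play inv tf m'v.
exists alice_strategy => t f r nc.
have /existsP[v /eqP fv] : [exists v, f v == None].
  apply: contra_notT nc => /existsPn all v; apply/eqP; exact: all.
case: t r => r; last first.
  have [m /andP[lm _]] : exists m, legal f m && (m.1 == v).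
    by apply: legal_color => //; apply: leq_trans (inv _ _ r v fv) _.
  by exists m.
have [w tf] : exists w, target f = Some w.
  rewrite /target; case: pickP => [w _|_]; first by exists w.
  case: pickP => [w _|none]; first by exists w.
  have Pv : (fun x => f x == None) v by rewrite fv.
  case: (@arg_minnP _ v (fun x => f x == None) dep Pv) => w /= fw wmin.
  have := none w; rewrite fw /= => /forallP[] u; apply/implyP; exact: wmin.
have [le2 fw] : #|active_children f w| <= 2 /\ f w = None.
  suff fw : f w = None by split=> //; case: (inv _ _ r) => + _; apply.
  move: tf; rewrite /target; case: pickP => [u /andP[/eqP fu _] [<-] //|_].
  by case: pickP => // u /andP[/eqP fu _] [<-].
have ex := legal_color fw le2; rewrite /alice_strategy tf.
case: pickP => [m /andP[lm _]|none]; first by exists m.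
by case: ex => m mE; have := none m; rewrite mE.
Qed.

End AliceStrategy.

(** * Cycles of a rooted forest with chords *)

Section Cycles.
Variables (G : sgraph) (up anc chord : rel G) (dep : G -> nat).
Variables (L : finType) (lab : G -> option L).
Hypothesis F : rooted_forest up anc dep.
Hypothesis edge_cases : forall x y : G, edge x y ->
  [|| up x y, up y x, chord x y | chord y x].
Hypothesis chord_lab : forall u w, chord u w ->
  lab u != None /\ lab w = lab u.
Hypothesis chord_uniq : forall u w u' w', chord u w -> chord u' w' ->
  lab u = lab u' -> u = u' /\ w = w'.
Hypothesis chord_cut : forall u w x y, chord u w -> up x y ->
  (anc x u != anc x w) = (lab x == lab u) && (lab y == lab u).

(** When [l] labels a chord, this is its fundamental cycle: by [chord_cut], a forest edge separates
    the ends of the chord exactly when both ends of the edge carry [l]. *)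
Definition edges_in (l : L) : {set {set G}} :=
  [set [set p.1; p.2] | p : G * G &
     [&& edge p.1 p.2, lab p.1 == Some l & lab p.2 == Some l]].

(** Without another crossing edge, membership in [A] would be constant along the cycle from
    [next c x] round to [x]. Size above two keeps the edges of the cycle distinct as sets. *)
Lemma ucycle_crosses_back (c : seq G) (A : pred G) x : uniq c ->
  2 < size c -> x \in c -> A x != A (next c x) ->
  exists y, [/\ y \in c, A y != A (next c y) &
    [set y; next c y] != [set x; next c x]].
Proof.
move=> u_c sz xc Ax.
have [/existsP[y /and3P[? ? ?]]|no] := boolP [exists y, [&& y \in c,
  A y != A (next c y) & [set y; next c y] != [set x; next c x]]].
  by exists y.
case/negP: Ax.
have : forall y, y \in c -> A y != A (next c y) ->
    [set y; next c y] = [set x; next c x].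
  move=> y yc Ay; apply/eqP; apply: contraR no => ne.
  by apply/existsP; exists y; rewrite yc Ay.
have [i s Es] := rot_to xc.
have nextE y : next c y = next (x :: s) y by rewrite -Es next_rot.
have memE y : (y \in c) = (y \in x :: s) by rewrite -Es mem_rot.
have u_s : uniq (x :: s) by rewrite -Es rot_uniq.
have sz_s : 1 < size s.
  by rewrite -ltnS -[(size s).+1]/(size (x :: s)) -Es size_rot.
move: sz_s; rewrite nextE.
case: s {Es} nextE memE u_s => [|z s] // nextE memE u_s sz_s.
rewrite /= eqxx => same.
have {}same y : y \in z :: s -> A y == A (next (x :: z :: s) y).
  move=> ys; apply: contraT => Ay.
  have yx : y != x by apply: contraTneq ys => ->; move: u_s => /andP[].
  have := same y; rewrite memE nextE inE ys orbT => /(_ isT Ay) E.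
  have yz : y = z.
    have : y \in [set x; z] by rewrite -E !inE eqxx.
    by rewrite !inE (negPf yx) => /eqP.
  have : x \in [set y; next (x :: z :: s) y] by rewrite E !inE eqxx.
  rewrite !inE eq_sym (negPf yx) yz /= => /eqP.
  have zx : z != x by rewrite -yz.
  rewrite (negPf zx); case: (s) sz_s u_s => // w s' _ u_s'.
  rewrite /= eqxx => xw.
  by move: u_s'; rewrite /= -xw !inE eqxx !orbT.
have pathA : path (fun y t => A y == A t) z (rcons s x).
  have : cycle (fun y t => (y != x) ==> (A y == A t)) (x :: z :: s).
    apply: cycle_from_next => // y ys; apply/implyP => yx.
    by apply: same; move: ys; rewrite inE (negPf yx).
  rewrite /= => /andP[_]; have xs : x \notin z :: s by move: u_s => /andP[].
  elim: (s) z xs {u_s sz_s same nextE memE} => [|w t IH] z /=.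
    by rewrite !inE => /negPf xz; rewrite eq_sym xz.
  rewrite inE negb_or eq_sym => /andP[xz xt] /andP[].
  by rewrite xz /= => -> /=; exact: IH.
have tr : transitive (fun y t => A y == A t) by move=> ? ? ? /eqP -> .
have /allP/(_ x) := order_path_min tr pathA.
by rewrite mem_rcons mem_head eq_sym; apply.
Qed.

(** The cut separates the descendants of [x] from the rest, and [x y] is the only forest edge across
    it. *)
Lemma edge_crosses x y z t : up x y -> edge z t -> anc x z != anc x t ->
  [set z; t] = [set x; y] \/
  exists u w, [/\ chord u w, [set z; t] = [set u; w] & anc x u != anc x w].
Proof.
move=> xy; have tree a b : up a b -> anc x a != anc x b ->
    [set a; b] = [set x; y].
  move=> ab; have [xa|ne] := eqVneq x a; last by rewrite (anc_up F ab ne) eqxx.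
  by rewrite -xa in ab *; rewrite (up_fun F ab xy).
case/edge_cases/or4P => zt ne.
- by left; exact: tree.
- by left; rewrite setUC; apply: tree; rewrite // eq_sym.
- by right; exists z, t.
- by right; exists t, z; rewrite setUC eq_sym.
Qed.

Lemma up_edge x y : up x y -> anc x x != anc x y.
Proof.
move=> xy; rewrite (anc_refl F); apply: contraL (up_dep F xy) => /eqP/esym.
by move/(anc_dep F); rewrite leqNgt.
Qed.

(** A cycle that crosses a cut crosses it by two different edges. So a forest edge of [C] comes with
    a chord of [C] across its cut and carries the label of that chord; hence the label is constant
    along [C], and [C] contains the one chord with this label. Conversely, a forest edge with this
    label separates the ends of that chord, and the second crossing of its cut can only be the edge
    itself. *)
Lemma cycle_edges C : is_cycle C -> exists l, C = edges_in l.
Proof.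
case=> c [/andP[e_c u_c] sz CE].
have inC x : x \in c -> [set x; next c x] \in C.
  by move=> xc; rewrite CE; apply/imsetP; exists x.
have e_next x : x \in c -> edge x (next c x) by exact: next_cycle.
have eC x y : up x y -> forall z, z \in c -> [set z; next c z] = [set x; y] ->
    exists u w, [/\ chord u w, [set u; w] \in C, lab x = lab u & lab y = lab u].
  move=> xy z zc E; have cr : anc x z != anc x (next c z).
    have := up_edge xy; have : z \in [set x; y] by rewrite -E !inE eqxx.
    have : next c z \in [set x; y] by rewrite -E !inE eqxx orbT.
    have := e_next z zc; rewrite !inE => e_z /orP[] /eqP n /orP[] /eqP zE.
    - by move: e_z; rewrite n -zE edge_irr.
    - by rewrite n zE eq_sym.
    - by rewrite n zE.
    - by move: e_z; rewrite n -zE edge_irr.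
  have [t [tc tcr tne]] := ucycle_crosses_back u_c sz zc cr.
  have [Et|[u [w [uw Et crt]]]] := edge_crosses xy (e_next t tc) tcr.
    by rewrite Et E eqxx in tne.
  exists u, w; rewrite -Et inC //; move: crt; rewrite (chord_cut uw xy).
  by case/andP => /eqP -> /eqP ->.
have labC x : x \in c -> exists u w, [/\ chord u w, [set u; w] \in C,
    lab x = lab u & lab (next c x) = lab u].
  move=> xc; case/or4P: (edge_cases (e_next x xc)) => xy.
  - exact: eC xy x xc erefl.
  - have [u [w [? ? ? ?]]] := eC _ _ xy x xc (setUC _ _).
    by exists u, w.
  - by exists x, (next c x); rewrite inC //; case: (chord_lab xy).
  - exists (next c x), x; rewrite setUC inC //.
    by case: (chord_lab xy).
have [x0 x0c] : exists x0, x0 \in c.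
  by case: (c) sz => // x0 s _; exists x0; rewrite mem_head.
have lab_c x : x \in c -> lab x = lab x0.
  have : cycle (fun x y => lab x == lab y) c.
    apply: cycle_from_next => // y /labC[u [w [_ _ -> ->]]]; exact: eqxx.
  have [i s Es] := rot_to x0c; rewrite -(rot_cycle i) Es /= => pathL.
  rewrite -(mem_rot i) Es inE => /orP[/eqP -> //|xs].
  have tr : transitive (fun x y => lab x == lab y) by move=> ? ? ? /eqP ->.
  have /allP/(_ x) := order_path_min tr pathL.
  by rewrite mem_rcons inE xs orbT => /(_ isT) /eqP.
have [u [w [uw uwC lab0 _]]] := labC x0 x0c.
have [lu lw] := chord_lab uw.
have [l El] : exists l, lab u = Some l by case: (lab u) lu => // l _; exists l.
exists l; apply/setP => S; apply/idP/idP.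
  rewrite CE => /imsetP[x xc ->]; apply/imsetP; exists (x, next c x) => //.
  by rewrite inE /= e_next // !lab_c ?mem_next // lab0 El !eqxx.
case/imsetP => [[a b]]; rewrite inE /= => /and3P[e_ab /eqP la /eqP lb] ->.
have ch a' b' : chord a' b' -> lab a' = Some l -> [set a'; b'] = [set u; w].
  move=> ab la'; rewrite -El in la'.
  by have [-> ->] := chord_uniq ab uw la'.
have tree a' b' : up a' b' -> lab a' = Some l -> lab b' = Some l ->
    [set a'; b'] \in C.
  move=> ab la' lb'; have := chord_cut uw ab.
  rewrite la' lb' El eqxx => cr.
  have [z zc Ez] : exists2 z, z \in c & [set u; w] = [set z; next c z].
    by move: uwC; rewrite CE => /imsetP.
  have crz : anc a' z != anc a' (next c z).
    have : z \in [set u; w] by rewrite Ez !inE eqxx.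
    have : next c z \in [set u; w] by rewrite Ez !inE eqxx orbT.
    have := e_next z zc; rewrite !inE => e_z /orP[] /eqP n /orP[] /eqP zE.
    - by move: e_z; rewrite n -zE edge_irr.
    - by rewrite n zE eq_sym cr.
    - by rewrite n zE cr.
    - by move: e_z; rewrite n -zE edge_irr.
  have [t [tc tcr tne]] := ucycle_crosses_back u_c sz zc crz.
  have [Et|[u' [w' [uw' Et crt]]]] := edge_crosses ab (e_next t tc) tcr.
    by rewrite -Et inC.
  have lab' : lab u' = Some l.
    move: crt; rewrite (chord_cut uw' ab) la' => /andP[/eqP <- _] //.
  by case/eqP: tne; rewrite Et (ch _ _ uw' lab') Ez.
case/or4P: (edge_cases e_ab) => ab.
- exact: tree.
- by rewrite setUC; exact: tree.
- by rewrite (ch a b).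
- by rewrite setUC (ch b a).
Qed.

Lemma cover_edges_in l x : x \in cover (edges_in l) -> lab x = Some l.
Proof.
case/bigcupP => S /imsetP[[a b]]; rewrite inE /=.
by case/and3P => _ /eqP la /eqP lb ->; rewrite !inE => /orP[] /eqP ->.
Qed.

(** A cycle is determined by its label, which can be read off an end of any of its edges. *)
Lemma cactus_chords : cactus G.
Proof.
move=> x y C1 C2 _ /cycle_edges[l1 ->] /cycle_edges[l2 ->] x1 x2.
have xin l : [set x; y] \in edges_in l -> lab x = Some l.
  move=> xl; apply: cover_edges_in; apply/bigcupP; exists [set x; y] => //.
  by rewrite !inE eqxx.
by have := xin _ x1; rewrite (xin _ x2) => -[->].
Qed.

End Cycles.

(** * The graph *)

Section Comb.
Variable L : nat.
Hypothesis L_gt0 : 0 < L.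

(** Enough for Bob's whole play: [bob_wins_arms] asks for [1 + 60 + 4 * (6 * L + 10)], that is
    [24 * L + 101], where the [1] is Alice's opening move. *)
Definition pend := 24 * L + 104.

(* The coordinates [(i, j, t, k, l)] place the row [i], the arm [j] and the
   position [t] along the arm; [k > 0] marks a pendant vertex of [(i, j, t)],
   and [l > 0] a leaf.  The vertices [(i, 0, 0, 0, 0)] form a path. *)
Definition vert : finType :=
  ('I_8 * 'I_5 * 'I_(6 * L + 8).+1 * 'I_pend.+1 * 'I_pend.+1)%type.

Implicit Types x y z : vert.
Definition ci x : nat := x.1.1.1.1.
Definition cj x : nat := x.1.1.1.2.
Definition ct x : nat := x.1.1.2.
Definition ck x : nat := x.1.2.
Definition cl x : nat := x.2.

Definition mk i j t k l : vert :=
  (inord i, inord j, inord t, inord k, inord l).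

Lemma vert_eqE x y : (x == y) =
  [&& ci x == ci y, cj x == cj y, ct x == ct y, ck x == ck y & cl x == cl y].
Proof.
case: x y => [[[[i j] t] k] l] [[[[i' j'] t'] k'] l'].
by rewrite !xpair_eqE /ci /cj /ct /ck /cl /= -!val_eqE /= -!andbA.
Qed.

Lemma ci_mk i j t k l : i < 8 -> ci (mk i j t k l) = i.
Proof. exact: inordK. Qed.
Lemma cj_mk i j t k l : j < 5 -> cj (mk i j t k l) = j.
Proof. exact: inordK. Qed.
Lemma ct_mk i j t k l : t <= 6 * L + 8 -> ct (mk i j t k l) = t.
Proof. by move=> le_t; apply: inordK; rewrite ltnS. Qed.
Lemma ck_mk i j t k l : k <= pend -> ck (mk i j t k l) = k.
Proof. by move=> le_k; apply: inordK; rewrite ltnS. Qed.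
Lemma cl_mk i j t k l : l <= pend -> cl (mk i j t k l) = l.
Proof. by move=> le_l; apply: inordK; rewrite ltnS. Qed.

Lemma ci_lt x : ci x < 8. Proof. exact: ltn_ord. Qed.
Lemma cj_lt x : cj x < 5. Proof. exact: ltn_ord. Qed.
Lemma ct_le x : ct x <= 6 * L + 8.
Proof. by rewrite -ltnS; exact: ltn_ord. Qed.
Lemma ck_le x : ck x <= pend. Proof. by rewrite -ltnS; exact: ltn_ord. Qed.
Lemma cl_le x : cl x <= pend. Proof. by rewrite -ltnS; exact: ltn_ord. Qed.

(** The first nonzero one among [l], [k], [t], [j], [i] changes: [t] and [i] drop by one, the others
    to zero, so all arms [j > 0] of a row hang directly from its path vertex. *)
Definition up : rel vert := fun x y =>
  if 0 < cl x then [&& cl y == 0, ck y == ck x, ct y == ct x, cj y == cj x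
    & ci y == ci x]
  else if 0 < ck x then [&& cl y == 0, ck y == 0, ct y == ct x, cj y == cj x
    & ci y == ci x]
  else if 0 < ct x then [&& cl y == 0, ck y == 0, (ct y).+1 == ct x,
    cj y == cj x & ci y == ci x]
  else if 0 < cj x then [&& cl y == 0, ck y == 0, ct y == 0, cj y == 0
    & ci y == ci x]
  else [&& cl y == 0, ck y == 0, ct y == 0, cj y == 0 & (ci y).+1 == ci x].

Definition anc : rel vert := fun x y =>
  if 0 < cl x then [&& cl y == cl x, ck y == ck x, ct y == ct x, cj y == cj x
    & ci y == ci x]
  else if 0 < ck x then [&& ck y == ck x, ct y == ct x, cj y == cj x
    & ci y == ci x]
  else if 0 < ct x then [&& ct x <= ct y, cj y == cj x & ci y == ci x]
  else if 0 < cj x then (cj y == cj x) && (ci y == ci x)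
  else ci x <= ci y.

Definition dep x := ci x + (0 < cj x) + ct x + (0 < ck x) + (0 < cl x).

(* Each chord closes an odd cycle along an arm: at positions [L .. 3L + 4] and
   [4L + 4 .. 6L + 8]. *)
Definition chord : rel vert := fun x y =>
  [&& cl x == 0, ck x == 0, cl y == 0, ck y == 0, cj y == cj x, ci y == ci x
    & ((ct x == 3 * L + 4) && (ct y == L))
      || ((ct x == 6 * L + 8) && (ct y == 4 * L + 4))].

Definition comb_edge : rel vert := fun x y =>
  [|| up x y, up y x, chord x y | chord y x].

Lemma comb_sym : symmetric comb_edge.
Proof.
move=> x y; rewrite /comb_edge orbCA; do 2 congr (_ || _).
by rewrite orbC.
Qed.

Ltac crush_if := repeat
  match goal with |- context [if ?b then _ else _] => case: (boolP b) => ? end.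
Ltac crush_and := repeat
  match goal with H : is_true (_ && _) |- _ => case/andP: H => ? ? end.
Ltac crush_or := repeat (crush_and; match goal with
  H : is_true (_ || _) |- _ => case/orP: H => ? end).

Lemma up_irr x : ~~ up x x.
Proof.
apply/negP; rewrite /up; crush_if => ?; crush_and; lia.
Qed.

Lemma chord_ct x y : chord x y -> ct y < ct x.
Proof. rewrite /chord => ?; crush_or; lia. Qed.

Lemma comb_irr : irreflexive comb_edge.
Proof.
move=> x; rewrite /comb_edge (negPf (up_irr x)) /=; apply/negP.
by rewrite orbb => /chord_ct; rewrite ltnn.
Qed.

Definition comb := SGraph comb_sym comb_irr.

Lemma coordP x y : ci x = ci y -> cj x = cj y -> ct x = ct y -> ck x = ck y ->
  cl x = cl y -> x = y.
Proof.
by move=> E1 E2 E3 E4 E5; apply/eqP; rewrite vert_eqE E1 E2 E3 E4 E5 !eqxx.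
Qed.

Lemma up_functional x y z : up x y -> up x z -> y = z.
Proof. by rewrite /up; crush_if => ? ?; crush_and; apply: coordP; lia. Qed.

Lemma comb_up_dep x y : up x y -> dep y < dep x.
Proof. by rewrite /up /dep; crush_if => ?; crush_and; lia. Qed.

Lemma comb_anc_refl x : anc x x.
Proof. by rewrite /anc !eqxx leqnn; crush_if. Qed.

Lemma comb_anc_up x y z : up y z -> x != y -> anc x y = anc x z.
Proof.
rewrite vert_eqE /up; crush_if => ?; crush_and; rewrite /anc; crush_if; lia.
Qed.

Lemma anc_parent_ex x y : anc x y -> x != y -> exists z, up y z.
Proof.
move=> xy ne.
have i8 := ci_lt y; have j5 := cj_lt y; have tL := ct_le y.
have kM := ck_le y; have lM := cl_le y.
have [l0|l0] := posnP (cl y); last first.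
  exists (mk (ci y) (cj y) (ct y) (ck y) 0).
  by rewrite /up l0 ci_mk // cj_mk // ct_mk // ck_mk // cl_mk // !eqxx.
have [k0|k0] := posnP (ck y); last first.
  exists (mk (ci y) (cj y) (ct y) 0 0).
  by rewrite /up l0 k0 ci_mk // cj_mk // ct_mk // ck_mk // cl_mk // !eqxx.
have [t0|t0] := posnP (ct y); last first.
  exists (mk (ci y) (cj y) (ct y).-1 0 0).
  rewrite /up l0 k0 t0 ci_mk // cj_mk // ct_mk ?(leq_trans (leq_pred _)) //.
  by rewrite ck_mk // cl_mk // prednK // !eqxx.
have [j0|j0] := posnP (cj y); last first.
  exists (mk (ci y) 0 0 0 0).
  by rewrite /up l0 k0 t0 j0 ci_mk // cj_mk // ct_mk // ck_mk // cl_mk // !eqxx.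
have [i0|i0] := posnP (ci y); last first.
  exists (mk (ci y).-1 0 0 0 0).
  rewrite /up l0 k0 t0 j0 ci_mk ?(leq_ltn_trans (leq_pred _)) //.
  by rewrite cj_mk // ct_mk // ck_mk // cl_mk // prednK // !eqxx.
suff E : x = y by rewrite E eqxx in ne.
move: xy; rewrite /anc; crush_if => ?; crush_and; apply: coordP; lia.
Qed.

Lemma comb_forest : rooted_forest up anc dep.
Proof.
split.
- exact: up_functional.
- exact: comb_up_dep.
- exact: comb_anc_refl.
- exact: comb_anc_up.
- exact: anc_parent_ex.
Qed.

Lemma comb_edge_cases (x y : comb) : edge x y ->
  [|| up x y, up y x, chord x y | chord y x].
Proof. by []. Qed.

(** * Labels of the cycles *)

Definition label : finType := ('I_8 * 'I_5 * bool)%type.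

Definition in_loop (b : bool) t :=
  if b then 4 * L + 4 <= t <= 6 * L + 8 else L <= t <= 3 * L + 4.

Arguments in_loop : simpl never.

Definition lab x : option label :=
  if (cl x == 0) && (ck x == 0) then
    if in_loop false (ct x) then Some (x.1.1.1.1, x.1.1.1.2, false)
    else if in_loop true (ct x) then Some (x.1.1.1.1, x.1.1.1.2, true)
    else None
  else None.

Lemma labE x (l : label) : (lab x == Some l) =
  [&& cl x == 0, ck x == 0, ci x == l.1.1, cj x == l.1.2 & in_loop l.2 (ct x)].
Proof.
case: l => [[i j] b] /=; rewrite /lab.
have [/andP[-> ->]|/nandP[]/negPf ->] := boolP (_ && _); rewrite /= ?andbF //.
have Some_eq b' : (Some (x.1.1.1.1, x.1.1.1.2, b') == Some (i, j, b)) =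
    [&& ci x == i, cj x == j & b' == b].
  by apply/eqP/and3P => [[<- <- <-]|[/eqP E1 /eqP E2 /eqP ->]];
    [rewrite !eqxx | congr (Some (_, _, _)); exact: val_inj].
have disj : in_loop false (ct x) -> in_loop true (ct x) = false.
  by rewrite /in_loop => ?; crush_and; apply/negP => ?; crush_and; lia.
have [ft tf] : ((false == true) = false) * ((true == false) = false) by [].
case: ifP => [in0|out0].
  by rewrite Some_eq; case: b {Some_eq};
    rewrite ?in0 ?(disj in0) ?ft ?eqxx ?andbF ?andbT.
case: ifP => [in1|out1].
  by rewrite Some_eq; case: b {Some_eq};
    rewrite ?in1 ?out0 ?tf ?eqxx ?andbF ?andbT.
by case: b {Some_eq}; rewrite ?out1 ?out0 !andbF.
Qed.

Lemma labP x (l : label) : lab x = Some l <->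
  [/\ cl x = 0, ck x = 0, ci x = l.1.1, cj x = l.1.2 & in_loop l.2 (ct x)].
Proof.
split=> [/eqP|[E1 E2 E3 E4 E5]].
  by rewrite labE; case/and5P => /eqP ? /eqP ? /eqP ? /eqP ? ?.
by apply/eqP; rewrite labE E1 E2 E3 E4 E5 !eqxx.
Qed.

Lemma chordP u w : chord u w -> exists l, [/\ lab u = Some l, lab w = Some l,
   ct u = if l.2 then 6 * L + 8 else 3 * L + 4
   & ct w = if l.2 then 4 * L + 4 else L].
Proof.
rewrite /chord => /and5P[/eqP ul /eqP uk /eqP wl /eqP wk].
case/and3P => /eqP ji /eqP ii /orP[] /andP[/eqP ut /eqP wt];
  [exists (u.1.1.1.1, u.1.1.1.2, false) | exists (u.1.1.1.1, u.1.1.1.2, true)];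
  split=> //; apply/labP; split; rewrite // /in_loop /= ?ut ?wt; lia.
Qed.

Lemma chord_lab (u w : comb) : chord u w -> lab u != None /\ lab w = lab u.
Proof. by case/chordP => l [-> -> _ _]. Qed.

Lemma chord_uniq (u w u' w' : comb) : chord u w -> chord u' w' ->
  lab u = lab u' -> u = u' /\ w = w'.
Proof.
case/chordP => l [lu lw tu tw] /chordP[l' [lu' lw' tu' tw']].
rewrite lu lu' => -[El]; subst l'.
move/labP: lu => [? ? ? ? _]; move/labP: lw => [? ? ? ? _].
move/labP: lu' => [? ? ? ? _]; move/labP: lw' => [? ? ? ? _].
by split; apply: coordP; congruence.
Qed.

(** The ends of a chord lie on one arm, and a forest edge separates them exactly when it joins
    consecutive positions of that arm within the loop. *)
Lemma chord_cut (u w x y : comb) : chord u w -> up x y ->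
  (anc x u != anc x w) = (lab x == lab u) && (lab y == lab u).
Proof.
case/chordP => l [lu lw tu tw] xy; rewrite lu !labE.
move/labP: lu => [ul uk ui uj _]; move/labP: lw => [wl wk wi wj _].
move: xy; rewrite /up /anc ul wl uk wk -ui -uj wi wj -ui -uj tu tw.
rewrite /in_loop; move: tu tw; clear -L_gt0.
case: (l.2) => _ _; crush_if => xy; crush_and; apply/idP/idP => ?; try lia.
Qed.

Lemma comb_cactus : cactus comb.
Proof.
exact: (@cactus_chords comb up anc chord dep label lab comb_forest
  comb_edge_cases chord_lab chord_uniq chord_cut).
Qed.

Lemma comb_cycle (C : {set {set comb}}) : is_cycle C ->
  exists l : label, C = edges_in (G := comb) lab l.
Proof.
exact: (@cycle_edges comb up anc chord dep label lab comb_forest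
  comb_edge_cases chord_lab chord_uniq chord_cut).
Qed.

(** * Girth and distance between cycles *)

Lemma at_least_min (P : nat -> Prop) (d : int) :
  (forall n, P n -> (d <= n%:Z)%R) -> at_least (min_nat P) d.
Proof.
move=> le_P; rewrite /min_nat; case: pselect => //= exP.
by case: ex_minnP => n /asboolP Pn _; exact: le_P.
Qed.

Lemma edge_mk i j t : i < 8 -> j < 5 -> t < 6 * L + 8 ->
  edge (mk i j t 0 0 : comb) (mk i j t.+1 0 0).
Proof.
move=> i8 j5 tL; apply/or4P; apply: Or42.
by rewrite /up !(ci_mk, cj_mk, ck_mk, cl_mk) // !ct_mk // ?eqxx // ltnW.
Qed.

(** Counting the [2 * L + 4] arm edges between the ends of the chord suffices; [s] is the position
    of its lower end. *)
Lemma girth_comb (C : {set {set comb}}) : is_cycle C -> L <= #|C|.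
Proof.
case/comb_cycle => [[[i j] b]] ->.
pose s := if b then 4 * L + 4 else L.
have sE : s + (2 * L + 4) = if b then 6 * L + 8 else 3 * L + 4.
  by rewrite /s; case: (b); clear; lia.
have s_le t : t < 2 * L + 4 -> s + t < 6 * L + 8.
  by rewrite /s; case: (b); clear; lia.
pose v t : comb := mk i j t 0 0.
have lv t : s <= t <= s + (2 * L + 4) -> lab (v t) = Some (i, j, b).
  move=> ht; have tL : t <= 6 * L + 8.
    by move: ht; rewrite sE => /andP[_]; case: (b); clear; lia.
  apply/labP; rewrite /v cl_mk // ck_mk // ci_mk // cj_mk // ct_mk //.
  split=> //.
  by move: ht; rewrite sE /s /in_loop /=; case: (b).
pose e (t : 'I_(2 * L + 4)) : {set comb} := [set v (s + t); v (s + t).+1].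
have e_inj : injective e.
  move=> t t' E; have [tL tL'] := (s_le _ (ltn_ord t), s_le _ (ltn_ord t')).
  have : v (s + t) \in e t' by rewrite -E !inE eqxx.
  have : v (s + t).+1 \in e t' by rewrite -E !inE eqxx orbT.
  rewrite !inE !vert_eqE /v !(ci_mk, cj_mk, ck_mk, cl_mk) //.
  rewrite !ct_mk // 1?ltnW // !eqxx /= !andbT => A B.
  by apply: val_inj; move: A B; clear; rewrite /=; lia.
have sub : e @: [set: 'I_(2 * L + 4)]
    \subset edges_in (G := comb) lab (i, j, b).
  apply/subsetP => _ /imsetP[t _ ->]; apply/imsetP.
  exists (v (s + t), v (s + t).+1) => //; have tL := ltn_ord t.
  have e_v : edge (v (s + t)) (v (s + t).+1).
    by apply: edge_mk; rewrite // s_le.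
  rewrite inE; apply/and3P; split; first exact: e_v.
    by rewrite /= lv //; move: tL; clear; lia.
  by rewrite /= lv //; move: tL; clear; lia.
have := subset_leq_card sub; rewrite card_imset // cardsT card_ord.
by apply: leq_trans; clear; lia.
Qed.

(* The distance to the cycle labelled [l], truncated at [L]. *)
Definition gap (l : label) x :=
  if (ci x == l.1.1) && (cj x == l.1.2) then
    minn L (if l.2 then (4 * L + 4 - ct x) + (ct x - (6 * L + 8))
            else (L - ct x) + (ct x - (3 * L + 4)))
  else L.

(** Both loops start at position [L] or later, so at position 0, where the arms meet, the truncated
    value [L] is taken in every row and arm. This makes [gap] vary slowly across edges joining
    different arms. *)
Lemma gap_root l x : ct x = 0 -> gap l x = L.
Proof.
move=> x0; rewrite /gap x0; case: ifP => // _.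
by case: (l.2); apply/minn_idPl; clear; lia.
Qed.

Lemma up_ct x y : up x y ->
  (ci y = ci x /\ cj y = cj x) /\ (ct y = ct x \/ (ct y).+1 = ct x)
  \/ ct x = 0 /\ ct y = 0.
Proof. by rewrite /up; crush_if => ?; crush_and; lia. Qed.

Lemma gap_up l x y : up x y ->
  gap l y <= (gap l x).+1 /\ gap l x <= (gap l y).+1.
Proof.
case/up_ct => [[[ii jj] tt]|[x0 y0]]; last by rewrite !gap_root.
rewrite /gap ii jj; case: ifP => // _; move: tt; case: (l.2); clear; lia.
Qed.

Lemma gap_edge l (x y : comb) : edge x y -> gap l y <= (gap l x).+1.
Proof.
(* Both ends have gap 0 if the chord is that of [l], and gap [L] otherwise, the two loops of an arm
   being [L] apart. *)
have gap_chord u w : chord u w -> gap l u = gap l w.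
  case/chordP => l' [/labP[_ _ iu ju _] /labP[_ _ iw jw _] tu tw].
  rewrite /gap iu ju iw jw tu tw; case: ifP => // _.
  by case: (l.2); case: (l'.2); clear; lia.
case/comb_edge_cases/or4P => [/(gap_up l)[]//|/(gap_up l)[]//|xy|xy].
  by rewrite (gap_chord x y xy).
by rewrite (gap_chord y x xy).
Qed.

Lemma gap_path l (x : comb) p : path (@edge comb) x p ->
  gap l (last x p) <= gap l x + size p.
Proof.
elim: p x => [|y p IH] x /=; first by rewrite addn0.
case/andP => /(gap_edge l) xy /IH /leq_trans; apply.
by rewrite addnS -addSn leq_add2r.
Qed.

(** Along the path, [gap l1] rises from 0 to [L] by at most one per edge. *)
Lemma distance_comb (x : comb) p C1 C2 : path (@edge comb) x p ->
  is_cycle C1 -> is_cycle C2 -> C1 <> C2 -> x \in cover C1 ->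
  last x p \in cover C2 -> L <= size p.
Proof.
move=> e_p /comb_cycle[l1 ->] /comb_cycle[l2 ->] ne.
move=> /cover_edges_in/labP[_ _ i1 j1 t1] /cover_edges_in/labP[_ _ i2 j2 t2].
have g1 : gap l1 x = 0.
  rewrite /gap i1 j1 !eqxx /=; move: t1; rewrite /in_loop.
  by case: (l1.2); clear; lia.
have := gap_path l1 e_p; rewrite g1 add0n; apply: leq_trans.
rewrite /gap i2 j2; case: ifP => [/andP[/eqP/val_inj ii /eqP/val_inj jj]|_];
  last exact: leqnn.
have bb : l1.2 != l2.2.
  apply: contra_notN ne => /eqP bb; congr (edges_in _ _).
  case: l1 l2 ii jj bb {i1 j1 t1 i2 j2 t2 g1} => [[i j] b] [[i' j'] b'] /=.
  by move=> -> -> ->.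
rewrite leq_min leqnn /=; move: t2 bb; rewrite /in_loop; clear.
by case: (l1.2); case: (l2.2); rewrite ?eqxx //= => /andP[lo hi] _; lia.
Qed.

(** * The game on the comb *)

Lemma chord_partner (x y z : comb) : chord x y || chord y x ->
  chord x z || chord z x -> y = z.
Proof.
have mixed u v w : chord u v -> chord w u -> False.
  case/chordP => l [lu _ tu _] /chordP[l' [_ lu' _ tu']].
  move: tu'; rewrite tu; have [->] : Some l = Some l' by rewrite -lu -lu'.
  by case: (l'.2); clear; lia.
case/orP => xy /orP[] xz.
- by case: (chord_uniq xy xz).
- by case: (mixed _ _ _ xy xz).
- by case: (mixed _ _ _ xz xy).
- have [_ ly] := chord_lab xy; have [_ lz] := chord_lab xz.
  by case: (chord_uniq xy xz); rewrite // -ly -lz.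
Qed.

Lemma comb_alice_wins5 : alice_wins comb 5.
Proof.
pose mate (x : comb) := [pick y | chord x y || chord y x].
apply: (@alice_wins5 comb up anc dep mate comb_forest) => x y.
case/comb_edge_cases/or4P => xy; rewrite ?xy ?orbT //.
  apply/or3P/Or33; rewrite /mate; case: pickP => [z xz|/(_ y)];
    last by rewrite xy.
  by rewrite (@chord_partner x y z) // xy.
apply/or3P/Or33; rewrite /mate; case: pickP => [z xz|/(_ y)];
  last by rewrite xy orbT.
by rewrite (@chord_partner x y z) // xy orbT.
Qed.

Definition inner : pred comb := fun x => cl x == 0.
Definition spine : pred comb := fun x => (cl x == 0) && (ck x == 0).
(** [lift ord0] runs through the nonzero values of a coordinate, here and in [kid]. *)
Definition leaf (x : comb) (j : 'I_pend) : comb := (x.1, lift ord0 j).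
Definition kid (x : comb) (j : 'I_pend) : comb := (x.1.1, lift ord0 j, ord0).

Lemma leaf_inj (x : comb) : injective (leaf x).
Proof. by move=> j j' /(congr1 snd) /lift_inj. Qed.

Lemma kid_inj (x : comb) : injective (kid x).
Proof. by move=> j j' /(congr1 (fun z => z.1.2)) /lift_inj. Qed.

Lemma up_cl (x y : comb) : up x y -> cl y = 0.
Proof. by rewrite /up; crush_if => ?; crush_and; apply/eqP. Qed.

Lemma chord_cl (x y : comb) : chord x y -> cl x = 0 /\ cl y = 0.
Proof. by case/chordP => l [/labP[] // + _ _ _ _ /labP[]]. Qed.

Lemma edge_leaf (x : comb) j (y : comb) : inner x ->
  edge (leaf x j) y = (y == x).
Proof.
move=> /eqP x0; have lj : 0 < cl (leaf x j) by [].
have noc z : chord (leaf x j) z = false.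
  by apply/negP => /chord_cl[E]; rewrite E in lj.
have noc' z : chord z (leaf x j) = false.
  by apply/negP => /chord_cl[_ E]; rewrite E in lj.
have nou z : up z (leaf x j) = false.
  by apply/negP => /up_cl E; rewrite E in lj.
rewrite /edge /= /comb_edge noc noc' nou !orbF /up lj vert_eqE x0.
rewrite -[cl y == 0]andbT.
by apply/and5P/and5P => -[? ? ? ? ?]; crush_and; split; rewrite ?andbT //.
Qed.

Lemma leaf_inner (x : comb) j : inner x -> ~~ inner (leaf x j).
Proof. by []. Qed.

Lemma spine_inner (x : comb) : spine x -> inner x.
Proof. by case/andP. Qed.

Lemma edge_kid (x : comb) j : spine x -> edge x (kid x j).
Proof.
case/andP => /eqP xl /eqP xk; apply/or4P/Or42.
by rewrite /up /= xl xk !eqxx.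
Qed.

Lemma kid_inner (x : comb) j : spine x -> inner (kid x j).
Proof. by []. Qed.

Lemma kid_spine (x : comb) j : spine x -> ~~ spine (kid x j).
Proof. by []. Qed.

Lemma path_mk i j a n (x : comb) : i < 8 -> j < 5 -> edge x (mk i j a 0 0) ->
  a + n <= 6 * L + 9 ->
  path (@edge comb) x [seq mk i j t 0 0 : comb | t <- iota a n].
Proof.
move=> i8 j5; elim: n a x => [|n IH] a x //= xa le_n.
apply/andP; split=> //; case: n IH le_n => [|n] // IH le_n.
apply: IH; last by move: le_n; clear; lia.
by apply: edge_mk => //; move: le_n; clear; lia.
Qed.

Lemma last_mk i j a n (x : comb) :
  last x [seq mk i j t 0 0 : comb | t <- iota a n.+1] = mk i j (a + n) 0 0.
Proof.
elim: n a x => [|n IH] a x /=; first by rewrite addn0.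
by have := IH a.+1 x; rewrite /= addSnnS => ->.
Qed.

(* Alice opens in some row; Bob plays in the four rows from [o]. *)
Section Window.
Variables (k o : nat).
Hypothesis k_le4 : k <= 4.
Hypothesis o_le4 : o <= 4.
Implicit Types f : coloring comb k.

Definition main (i : 'I_4) : comb := mk (o + i) 0 0 0 0.
Definition arm_at (i j : 'I_4) t : comb := mk (o + i) j.+1 t 0 0.
Definition arm i j := [seq arm_at i j t | t <- iota 0 (6 * L + 9)].
(** Bob attacks the farther cycle of the arm; the nearer one is kept for switching parity. *)
Definition top i j := arm_at i j (4 * L + 4).
Definition loop i j := [seq arm_at i j t | t <- iota (4 * L + 5) (2 * L + 4)].

Lemma row_lt (i : 'I_4) : o + i < 8.
Proof. by rewrite -addnS (leq_add o_le4 (ltn_ord i)). Qed.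

Lemma col_lt (j : 'I_4) : j.+1 < 5.
Proof. by rewrite ltnS ltn_ord. Qed.

Lemma arm_atE i j t : t <= 6 * L + 8 -> [/\ ci (arm_at i j t) = o + i,
  cj (arm_at i j t) = j.+1, ct (arm_at i j t) = t, ck (arm_at i j t) = 0
  & cl (arm_at i j t) = 0].
Proof.
move=> tL; rewrite /arm_at ci_mk ?row_lt // cj_mk ?col_lt // ct_mk //.
by rewrite ck_mk // cl_mk.
Qed.

Lemma mem_arm i j x : x \in arm i j ->
  exists2 t, t <= 6 * L + 8 & x = arm_at i j t.
Proof.
case/mapP => t; rewrite mem_iota add0n addnS ltnS => /andP[_ tL] ->.
by exists t.
Qed.

Lemma arm_at_mem i j t : t <= 6 * L + 8 -> arm_at i j t \in arm i j.
Proof.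
by move=> tL; apply: map_f; rewrite mem_iota /= add0n addnS ltnS.
Qed.

Lemma main_inj : injective main.
Proof.
move=> i i' /(congr1 ci); rewrite !ci_mk ?row_lt // => /addnI.
exact: val_inj.
Qed.

Lemma main_spine i : spine (main i).
Proof. by rewrite /spine cl_mk // ck_mk. Qed.

Lemma edge_main (i i' : 'I_4) : i' = i.+1 :> nat -> edge (main i) (main i').
Proof.
move=> ii; apply/or4P/Or42; rewrite /up !(ck_mk, cl_mk, cj_mk, ct_mk) //=.
by rewrite !ci_mk ?row_lt // ii addnS.
Qed.

Lemma main_arm i i' j : main i \notin arm i' j.
Proof.
apply/negP => /mem_arm[t tL /(congr1 cj)].
by case: (arm_atE i' j tL) => _ -> _ _ _; rewrite cj_mk.
Qed.

Lemma arm_disj i j i' j' x : x \in arm i j -> x \in arm i' j' ->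
  (i, j) = (i', j').
Proof.
case/mem_arm => t tL -> /mem_arm[t' tL'] E.
have [ci1 cj1 _ _ _] := arm_atE i j tL.
have [ci2 cj2 _ _ _] := arm_atE i' j' tL'.
move: ci1 cj1; rewrite E ci2 cj2 => /addnI/val_inj -> [/val_inj ->] //.
Qed.

Lemma size_arm i j : size (arm i j) < 6 * L + 10.
Proof. by rewrite size_map size_iota ltn_add2l. Qed.

Lemma arm_spine i j : all spine (arm i j).
Proof.
apply/allP => x /mem_arm[t tL ->]; rewrite /spine.
by have [_ _ _ -> ->] := arm_atE i j tL.
Qed.

Lemma loop_arm i j : {subset top i j :: loop i j <= arm i j}.
Proof.
move=> x; rewrite inE => /orP[/eqP ->|/mapP[t]].
  by apply: arm_at_mem; clear; lia.
rewrite mem_iota => tL ->; apply: arm_at_mem; move: tL; clear; lia.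
Qed.

Lemma top_loopE i j : top i j :: loop i j =
  [seq arm_at i j t | t <- iota (4 * L + 4) (2 * L + 5)].
Proof. by rewrite [2 * L + 5]addnS /= /loop [4 * L + 5]addnS. Qed.

Lemma uniq_arm_at i j s : uniq s -> all (fun t => t <= 6 * L + 8) s ->
  uniq [seq arm_at i j t | t <- s].
Proof.
move=> u_s /allP le_s; rewrite map_inj_in_uniq // => t t' /le_s tL /le_s tL' E.
have [_ _ <- _ _] := arm_atE i j tL; have [_ _ <- _ _] := arm_atE i j tL'.
by rewrite E.
Qed.

Lemma loop_uniq i j : uniq (top i j :: loop i j).
Proof.
rewrite top_loopE uniq_arm_at ?iota_uniq //; apply/allP => t.
by rewrite mem_iota; clear; lia.
Qed.

Lemma edge_arm i j t : t < 6 * L + 8 -> edge (arm_at i j t) (arm_at i j t.+1).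
Proof. by move=> tL; apply: edge_mk; rewrite ?row_lt ?col_lt. Qed.

Lemma edge_chord i j (b : bool) :
  edge (arm_at i j (if b then 6 * L + 8 else 3 * L + 4))
       (arm_at i j (if b then 4 * L + 4 else L)).
Proof.
apply/or4P/Or43; rewrite /chord.
have tL : (if b then 6 * L + 8 else 3 * L + 4) <= 6 * L + 8.
  by case: b; clear; lia.
have sL : (if b then 4 * L + 4 else L) <= 6 * L + 8 by case: (b); clear; lia.
have [-> -> -> -> ->] := arm_atE i j tL.
have [-> -> -> -> ->] := arm_atE i j sL.
by rewrite !eqxx; clear tL sL; case: b; rewrite !eqxx ?orbT.
Qed.

Lemma loop_cycle i j : cycle (@edge comb) (top i j :: loop i j).
Proof.
rewrite /= rcons_path path_mk ?row_lt ?col_lt //=.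
- rewrite /loop [2 * L + 4]addnS last_mk.
  have -> : 4 * L + 5 + (2 * L + 3) = 6 * L + 8 by clear; lia.
  exact: (edge_chord i j true).
- by rewrite [4 * L + 5]addnS; apply: edge_arm; clear; lia.
- by clear; lia.
Qed.

Lemma size_loop i j : size (loop i j) = 2 * L + 4.
Proof. by rewrite size_map size_iota. Qed.

Lemma loop_odd i j : ~~ odd (size (loop i j)).
Proof. by rewrite size_loop oddD oddM. Qed.

Lemma loop_size i j : 3 < size (loop i j) < 6 * L + 10.
Proof. by rewrite size_loop; clear; lia. Qed.

(** Alice's vertex has position [t0] on the farther loop. Position [t0 - 1], where her color is
    forbidden, is reached from the start of the arm either straight or over the chord of the nearer
    loop. The chord skips the [2 * L + 3] positions strictly between its ends, an odd number, so
    both parities occur. *)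
Lemma loop_live f i j (x : comb) c : x \in top i j :: loop i j ->
  (forall w, w \in arm i j -> w != x -> f w = None) ->
  (forall w, edge x w -> forb f w c) -> live inner f (arm i j) (main i).
Proof.
rewrite top_loopE => /mapP[t0]; rewrite mem_iota => t0L -> blank fc.
have [t Et] : exists t, t0 = t.+1.
  by exists t0.-1; rewrite prednK //; move: t0L; clear -L_gt0; lia.
have e_main : edge (main i) (arm_at i j 0).
  apply/or4P/Or42; rewrite /up.
  have [-> -> -> -> ->] := arm_atE i j (leq0n _).
  by rewrite !(ck_mk, cl_mk, cj_mk, ct_mk) // ci_mk ?row_lt ?eqxx.
have tail_path a n (y : comb) : edge y (arm_at i j a) -> a + n <= 6 * L + 9 ->
    path (@edge comb) y [seq arm_at i j t | t <- iota a n].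
  by apply: path_mk; [exact: row_lt | exact: col_lt].
pose long := iota 0 t0.
pose short := iota 0 L.+1 ++ iota (3 * L + 4) (t0 - (3 * L + 4)).
(* [long] has [t0] vertices, whence the test on [odd t0]. *)
exists c, (fun b =>
  [seq arm_at i j s | s <- if odd t0 == b then long else short]).
move=> b; set s := if _ then _ else _.
have s_lt u : u \in s -> u < t0.
  rewrite /s; case: ifP => _; first by rewrite mem_iota.
  by rewrite mem_cat !mem_iota; move: t0L; clear -L_gt0; lia.
have s_le u : u \in s -> u <= 6 * L + 8.
  by move/s_lt; move: t0L; clear; lia.
have u_s : uniq s.
  rewrite /s; case: ifP => _; first exact: iota_uniq.
  rewrite cat_uniq !iota_uniq andTb andbT; apply/hasPn => u.
  by rewrite !mem_iota; clear; lia.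
have last_s : last (main i) [seq arm_at i j u | u <- s] = arm_at i j t.
  rewrite /s; case: ifP => _; first by rewrite /long Et last_mk.
  rewrite map_cat last_cat.
  have -> : t0 - (3 * L + 4) = (t - (3 * L + 4)).+1.
    by move: t0L; rewrite Et; clear -L_gt0; lia.
  by rewrite last_mk subnKC //; move: t0L; rewrite Et; clear -L_gt0; lia.
split.
- rewrite /s; case: ifP => _.
    by apply: tail_path => //; move: t0L; clear; lia.
  rewrite map_cat cat_path tail_path //=; last by clear; lia.
  have -> : last (arm_at i j 0) [seq arm_at i j t | t <- iota 1 L] =
      arm_at i j L.
    by have := @last_mk (o + i) j.+1 0 L (main i).
  apply: tail_path; first by rewrite edge_sym; exact: (edge_chord i j false).
  by move: t0L; clear; lia.
- by apply: uniq_arm_at => //; apply/allP => u; exact: s_le.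
- by move=> _ /mapP[u /s_le uL ->]; exact: arm_at_mem.
- split; last split.
  + apply/allP => _ /mapP[u us ->]; have uL := s_le u us.
    rewrite /inner; have [_ _ Eu _ ->] := arm_atE i j uL.
    rewrite eqxx blank ?arm_at_mem //; apply/eqP => E.
    have t0L' : t0 <= 6 * L + 8 by move: t0L; clear; lia.
    have [_ _ Et0 _ _] := arm_atE i j t0L'.
    by have := s_lt u us; rewrite -Eu E Et0 ltnn.
  + rewrite size_map /s; case: eqP => [<-|/eqP ne]; first by rewrite size_iota.
    have E : t0 = L.+1 + (t0 - (3 * L + 4)) + (2 * L + 3).
      by move: t0L; clear; lia.
    rewrite size_cat !size_iota; move: ne; rewrite {1}E !oddD /=.
    by clear; case: (odd L); case: (odd (_ - _)); case: b.
  + rewrite last_s; apply: fc; rewrite Et edge_sym; apply: edge_arm.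
    by move: t0L; rewrite Et; clear; lia.
Qed.

Lemma comb_bob_wins f : (forall i, f (main i) = None) ->
  (forall i j t, t <= 6 * L + 8 -> f (arm_at i j t) = None) ->
  #|colored f| <= 1 -> bob_wins Bob f.
Proof.
move=> f_main f_arm le1.
apply: (bob_wins_arms k_le4 leaf_inj edge_leaf leaf_inner spine_inner kid_inj
  edge_kid kid_inner kid_spine main_inj main_spine edge_main main_arm arm_disj
  size_arm loop_cycle loop_uniq loop_odd loop_size loop_arm arm_spine) => //.
- by move=> g i j x c; exact: loop_live.
- move=> i j; apply/allP => x /mem_arm[t tL ->]; rewrite f_arm // eqxx andbT.
  by rewrite /inner; have [_ _ _ _ ->] := arm_atE i j tL.
- by move: le1; rewrite /pend; clear; lia.
Qed.

End Window.

Lemma comb_not_alice_wins k : k <= 4 -> ~ alice_wins comb k.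
Proof.
move=> k_le4 [s win]; have root : blank comb k (mk 0 0 0 0 0) = None.
  by rewrite ffunE.
have := ReachedBlank s; apply: (bob_wins_reply root) win => m lm.
(* Of the two blocks of four rows, Bob takes the one without Alice's opening move. *)
pose o := if ci m.1 < 4 then 4 else 0.
have o_le4 : o <= 4 by rewrite /o; case: ifP.
have row_m i : o + i == ci m.1 -> i < 4 -> False.
  by rewrite /o; case: ifP; clear; lia.
apply: (comb_bob_wins (k := k) k_le4 o_le4).
- move=> i; rewrite play_other ?ffunE //; apply/eqP => E.
  by apply: (row_m i _ (ltn_ord i)); rewrite -E /main ci_mk ?row_lt.
- move=> i j t tL; rewrite play_other ?ffunE //; apply/eqP => E.
  apply: (row_m i _ (ltn_ord i)); rewrite -E.
  by have [-> _ _ _ _] := arm_atE o_le4 i j tL.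
- rewrite card_colored_play // ltnS leqn0 cards_eq0.
  by apply/eqP/setP => v; rewrite !inE ffunE.
Qed.

Lemma chi_comb : game_chromatic_number comb = 5.
Proof.
rewrite /game_chromatic_number; case: ex_minnP => n /asboolP win_n min_n.
apply/eqP; rewrite eqn_leq min_n; last exact/asboolP/comb_alice_wins5.
by rewrite ltnNge; apply/negP => /comb_not_alice_wins.
Qed.

End Comb.

Lemma le_int_nat (d : int) n : absz d <= n -> (d <= n%:Z)%R.
Proof. by case: d. Qed.

Theorem theorem1 (d k : int) :
  exists CT : sgraph,
    [/\ cactus CT, at_least (girth CT) k, at_least (cycle_distance CT) d
      & game_chromatic_number CT = 5].
Proof.
(* A single [L] serves as lower bound for both the girth and the distance; absolute values turn the
   integer bounds into natural ones, and the successor makes [L] positive. *)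
pose L := (absz d + absz k).+1; have L_gt0 : 0 < L by [].
exists (comb L_gt0); split.
- exact: comb_cactus.
- apply: at_least_min => n [C /girth_comb le_L <-]; apply: le_int_nat.
  by apply: leq_trans le_L; rewrite leqW // leq_addl.
- apply: at_least_min => n [x [p [C1 [C2 [[e_p _ <-] [c1 c2 ne x1 x2]]]]]].
  apply/le_int_nat/(leq_trans _ (distance_comb e_p c1 c2 ne x1 x2)).
  by rewrite leqW // leq_addr.
- exact: chi_comb.
Qed.
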